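(* Let $2\le q<\infty$, let $\Omega\subset\mathbb{R}^d$ be compact with a probability measure $\mu$, and let $X_N\subset \mathcal{C}(\Omega)$ be an $N$-dimensional subspace satisfying the Nikol'skii type inequality $$\|f\|_\infty \le B N^{1/q}\|f\|_q \quad \text{for all } f\in X_N,$$ where $B\ge 1$. Then for any $\epsilon\in(0,1)$ there is a large enough constant $C=C(q,\epsilon)$ (depending only on $q$ and $\epsilon$) such that there exist $$m \le C B^{q}N(\log_2 (2BN))^3$$ points $\xi^j\in \Omega$, $j=1,\dots,m$, such that for any $f\in X_N$ $$(1-\epsilon)\|f\|_q^q \le \frac{1}{m}\sum_{j=1}^m |f(\xi^j)|^q \le (1+\epsilon)\|f\|_q^q.$$
   Context: $\mathcal{C}(\Omega)$ is the space of continuous functions on $\Omega$. For $1\le q<\infty$, $\|f\|_q:=\left(\int_\Omega |f|^q\,d\mu\right)^{1/q}$, and $\|f\|_\infty:=\max_{\mathbf{x}\in\Omega}|f(\mathbf{x})|$ (uniform norm). The points $\xi^1,\dots,\xi^m$ form a finite family; repetitions are allowed. *)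

(* Defs.v *)
From HB Require Import structures.
From mathcomp Require Import all_boot all_order all_algebra.
From mathcomp Require Import all_classical all_reals all_analysis.

Set Implicit Arguments.
Unset Strict Implicit.
Unset Printing Implicit Defensive.

Import Order.TTheory GRing.Theory Num.Theory.
Import numFieldNormedType.Exports.

Local Open Scope classical_set_scope.
Local Open Scope ring_scope.

Definition borel_rV (R : realType) (d : nat) :=
  g_sigma_algebraType (@open 'rV[R]_d).

Definition log2 (R : realType) (x : R) : R := ln x / ln 2.

Definition is_subspace_of_dim (K : fieldType) (V : lmodType K)
    (X : set V) (N : nat) : Prop :=
  exists u : 'I_N -> V,
    (forall c : 'I_N -> K, \sum_i c i *: u i = 0 -> forall i, c i = 0) /\
    X = [set f | exists c : 'I_N -> K, f = \sum_i c i *: u i].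

(* The real-valued continuous functions on Omega, each one represented by its
   extension by zero to R^d. This representation is unique, so that linear
   independence in the space of functions on R^d is linear independence in
   C(Omega). The codomain is R^o so that functions form an R-module. *)
Definition Ccont (R : realType) (d : nat) (Omega : set 'rV[R]_d) :
    set ('rV[R]_d -> R^o) :=
  [set f | {within Omega, continuous f} /\ forall x, ~ Omega x -> f x = 0].

(* A maximum when Omega is compact and nonempty and f is continuous on it. *)
Definition unif_norm (R : realType) (d : nat) (Omega : set 'rV[R]_d)
    (f : 'rV[R]_d -> R) : R :=
  sup [set `|f x| | x in Omega].

(* Finite when mu is a probability measure and f is bounded and measurable.
   If mu is concentrated on Omega, integrating over R^d or over Omega is
   the same. *)
Definition Lq_norm (R : realType) (d : nat) (mu : probability (borel_rV R d) R)
    (q : R) (f : 'rV[R]_d -> R) : R :=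
  fine ('N[mu]_(q%:E)[EFin \o f])%E.

(* Main.v *)
Require Import Defs.
From HB Require Import structures.
From mathcomp Require Import all_boot all_order all_algebra.
From mathcomp Require Import all_classical all_reals all_analysis.
From mathcomp Require Import measurable_realfun.
From mathcomp Require Import ring lra zify.

Set Implicit Arguments.
Unset Strict Implicit.
Unset Printing Implicit Defensive.

Import Order.TTheory GRing.Theory Num.Theory.
Import numFieldNormedType.Exports.

Local Open Scope classical_set_scope.
Local Open Scope ring_scope.

(** Start from a huge sample that discretizes the norm almost exactly, and throw
   away half of its points again and again, until about
   [B ^ q * N * log (2 B N) ^ 3] of them are left.

   A huge sample exists for soft reasons ([initial_discretization]): on a
   sufficiently fine finite partition of [Omega] every [f] in [X] oscillates
   little compared with its norm, and the masses of the cells can be rounded to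
   multiples of the inverse of a large number of points.

   One halving ([halving_step]) groups the [2 n] points in pairs and keeps one
   point of each pair at random. For a fixed [f] the mean of [|f| ^ q] then moves
   by a Rademacher sum, which is small by Hoeffding's inequality. To get all [f]
   with mean of [|f| ^ q] at most [1] at once, one uses a union bound over nets,
   one net for each level set: with [P] such that [|f| ^ q <= P] for these [f],
   let [t] run over the scales [P ^ (1 / q) / 2 ^ k]. The part of [|f| ^ q] that
   comes from values of size about [t] has variance at most [t ^ q] times the
   mean of [|f| ^ q], so it tolerates a net with [exp (c * P / t ^ q * log n)]
   elements; and to know this part with a small relative error it is enough to
   know [f] up to a small multiple of [t] at all points ([level_approx]). The
   two powers of [t] cancel. There are about [log n] levels, each costs a
   deviation [(P * log n / n) ^ (1 / 2)], and the resulting condition is that [n]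
   exceeds a multiple of [P * log n ^ 3]: this is where the third power of the
   logarithm comes from.

   The nets are the main point ([greedy_net]). Since [2 <= q], the [q]-th power
   of the norm is uniformly convex (Clarkson), hence the Legendre dual of it is
   uniformly smooth and gradient descent in the dual space converges quickly:
   after [c * P / t ^ q] steps, each of which adds a signed evaluation at one of
   the [2 n] points, the primal point is [t]-close to [f] at all points. The
   path of the algorithm is a word of at most this length over [4 n] letters, and
   the number of words bounds the size of the net.

   The relative errors of the halvings grow geometrically while the number of
   points decreases to its final value, so that their sum is small if the last
   one is ([thinning]). Since the empirical norm stays within a factor [2] of
   the original one, the bound [|f| ^ q <= P] keeps its form during the
   process. *)

(** * Real inequalities *)

Section real_lemmas.
Variable R : realType.
Implicit Types (q a b t u v x y : R).

Lemma ler_powR_base q x y : 0 <= q -> 0 <= x -> x <= y -> x `^ q <= y `^ q.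
Proof.
by move=> q0 x0 xy; rewrite ge0_ler_powR// nnegrE// (le_trans x0).
Qed.

(** Young's inequality for [b * a `^ (q - 1)]. *)
Lemma powRB_le q a b : 1 < q -> 0 <= b <= a ->
  a `^ q - b `^ q <= q * a `^ (q - 1) * (a - b).
Proof.
move=> q1 /andP[b0 ba]; have a0 := le_trans b0 ba.
have q0 : 0 < q by lra.
have q1' : 0 < q - 1 by lra.
have := @conjugate_powR R b (a `^ (q - 1)) q (q / (q - 1)) b0 (powR_ge0 _ _) q0.
have -> : (a `^ (q - 1)) `^ (q / (q - 1)) = a `^ q.
  by rewrite -powRrM mulrCA mulfV ?mulr1 ?gt_eqF.
move=> /(_ (divr_gt0 q0 q1')) H.
have {}H : b * a `^ (q - 1) <= b `^ q / q + a `^ q / (q / (q - 1)).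
  by apply: H; field; rewrite !gt_eqF.
have E : b `^ q / q + a `^ q / (q / (q - 1)) =
   (b `^ q + a `^ q * (q - 1)) / q by field; rewrite !gt_eqF.
move: H; rewrite E ler_pdivlMr// => H.
have := mulr_powRB1 a0 q0; move: H; set A := a `^ (q-1) => H EA.
rewrite -EA in H *; lra.
Qed.

Lemma powR_lipschitz q t x y : 1 < q -> 0 <= x <= t -> 0 <= y <= t ->
  `|x `^ q - y `^ q| <= q * t `^ (q - 1) * `|x - y|.
Proof.
move=> q1; wlog yx : x y / y <= x => [H hx hy|].
  have [yx|/ltW xy] := leP y x; first exact: H.
  by rewrite distrC [`|x - y|]distrC; apply: H.
move=> /andP[x0 xt] /andP[y0 yt].
rewrite !ger0_norm ?subr_ge0//; last by apply: ler_powR_base; lra.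
apply: le_trans (powRB_le q1 _) _; first by rewrite y0 yx.
apply: ler_wpM2r; first lra.
by apply: ler_wpM2l; [lra|apply: ler_powR_base; lra].
Qed.

(** The parallelogram identity, raised to the power [q / 2 >= 1]: superadditivity of
   this power bounds the left-hand side by [((a ^ 2 + b ^ 2) / 2) ^ (q / 2)], and
   convexity bounds the latter by the right-hand side. *)
Lemma clarkson_scalar q a b : 2 <= q ->
  `|(a + b) / 2| `^ q + `|(a - b) / 2| `^ q <= (`|a| `^ q + `|b| `^ q) / 2.
Proof.
move=> q2; set r := q / 2; have r1 : 1 <= r by rewrite /r; lra.
have sq u : `|u| `^ q = (u ^+ 2) `^ r.
  by rewrite -(real_normK (num_real u)) -powR_mulrn// -powRrM /r mulrCA divff
     ?mulr1// pnatr_eq0.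
rewrite !sq; set x := ((a + b) / 2) ^+ 2; set y := ((a - b) / 2) ^+ 2.
have x0 : 0 <= x by apply: sqr_ge0.
have y0 : 0 <= y by apply: sqr_ge0.
have xy : x + y = 2^-1 * a ^+ 2 + 2^-1 * b ^+ 2 by rewrite /x /y; field.
have r0 : 0 < r by lra.
apply: (@le_trans _ _ ((x + y) `^ r)).
  rewrite -(mulr_powRB1 x0)// -(mulr_powRB1 y0)// -(mulr_powRB1 (addr_ge0 x0 y0))//.
  by rewrite mulrDl lerD// ler_wpM2l// ler_powR_base; lra.
rewrite xy [leRHS]mulrC mulrDr.
have a0 : 0 <= a ^+ 2 by apply: sqr_ge0.
have b0 : 0 <= b ^+ 2 by apply: sqr_ge0.
have h0 : (0:R) <= 2^-1 by lra.
have h1 : (2^-1:R) <= 1 by lra.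
have := @convex_powR R r r1 (Itv01 h0 h1) (a ^+ 2) (b ^+ 2).
rewrite !inE /= !in_itv /= !andbT convRE => /(_ a0 b0) /=.
rewrite [conv _ _ _]convRE /=.
by rewrite (_ : unstable.onem 2^-1 = 2^-1 :> R)// /unstable.onem; field.
Qed.

(** The layer of [|u| ^ q] between the heights [t / 2] and [t]: over a dyadic
   sequence of scales the layers telescope to [|u| ^ q]. *)
Definition level q t u := Num.min `|u| t `^ q - Num.min `|u| (t / 2) `^ q.

Lemma level_ge0 q t u : 0 < t -> 0 <= q -> 0 <= level q t u.
Proof.
move=> t0 q0; rewrite subr_ge0 ler_powR_base//.
  by rewrite le_min normr_ge0; lra.
by rewrite le_min !ge_min lexx/=; apply/orP; right; lra.
Qed.

Lemma level_le q t u : 0 < t -> 0 <= q -> level q t u <= t `^ q.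
Proof.
move=> t0 q0; have := powR_ge0 (Num.min `|u| (t / 2)) q.
suff : Num.min `|u| t `^ q <= t `^ q by rewrite /level; lra.
by rewrite ler_powR_base// ?ge_min ?lexx ?orbT// le_min normr_ge0; lra.
Qed.

Lemma level_small q t u : 0 < t -> `|u| <= t / 2 -> level q t u = 0.
Proof.
move=> t0 ut; rewrite /level !min_l ?subrr//; lra.
Qed.

Lemma level_large q t u : 0 < t -> 2 <= q -> t <= `|u| ->
  3 / 4 * t `^ q <= level q t u.
Proof.
move=> t0 q2 tu; rewrite /level !min_r; [|lra..].
rewrite powRM; [|lra..].
have : (2^-1) `^ q <= 4^-1 :> R.
  have -> : (4^-1 : R) = (2^-1) `^ 2%:R by rewrite powR_mulrn; [field|lra].
  by apply: ger_powR; lra.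
by have := powR_ge0 t q; nra.
Qed.

(** A layer vanishes at values smaller than [t / 2], and at larger values a
   perturbation by [d * t] is a relative perturbation. The factor [4] on the
   right makes the layer of [4 * u] full as soon as [|u|] reaches [t / 4], that
   is, wherever the layer of [u] or of [v] can be nonzero; the right-hand sides
   still telescope over the scales. *)
Lemma level_approx q t d u v : 2 <= q -> 0 < t -> 0 < d <= 4^-1 ->
  `|u - v| <= d * t ->
  level q t v <= 2 * level q t (4 * u) /\
  `|level q t u - level q t v| <= 4 * q * d * level q t (4 * u).
Proof.
move=> q2 t0 /andP[d0 d4] uv.
have q0 : 0 <= q by lra.
have L0 : 0 <= level q t (4 * u) by apply: level_ge0.
have dt : d * t <= t / 4 by nra.
have [ut|ut] := ltP `|u| (t / 4).
  have vt : `|v| <= t / 2.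
    have : `|u - (u - v)| <= `|u| + `|u - v| by exact: ler_normB.
    by rewrite subKr => ?; lra.
  rewrite (level_small q t0 vt) (@level_small q t u) ?subrr ?normr0//; last lra.
  by split; rewrite !mulr_ge0 ?(ltW d0).
have L : 3 / 4 * t `^ q <= level q t (4 * u).
  by apply: level_large => //; rewrite normrM ger0_norm; lra.
split; first by have := level_le v t0 q0; have := powR_ge0 t q; lra.
have q1 : 1 < q by lra.
have mn c : 0 < c -> `|Num.min `|u| c - Num.min `|v| c| <= d * t.
  move=> c0; apply: le_trans uv; apply: le_trans (ler_dist_dist _ _).
  rewrite ler_norml; have [H1|H1] := leP `|u| c; have [H2|H2] := leP `|v| c;
    have := ler_norm (`|u| - `|v|); have := ler_norm (`|v| - `|u|);
    rewrite [`|(`|v| - `|u|)|]distrC; move=> *; apply/andP; split; lra.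
have lip c : 0 < c -> c <= t ->
    `|Num.min `|u| c `^ q - Num.min `|v| c `^ q| <= q * d * t `^ q.
  move=> c0 ct.
  apply: le_trans (@powR_lipschitz q c _ _ q1 _ _) _.
  - by rewrite le_min normr_ge0 ge_min lexx orbT ltW.
  - by rewrite le_min normr_ge0 ge_min lexx orbT ltW.
  apply: le_trans (ler_wpM2l _ (mn _ c0)) _; first by rewrite mulr_ge0 ?powR_ge0.
  have : c `^ (q - 1) <= t `^ (q - 1) by apply: ler_powR_base; lra.
  rewrite -(mulr_powRB1 (ltW t0) (_ : 0 < q)); last lra.
  move=> ?; rewrite -!mulrA; apply: ler_wpM2l => //.
  by rewrite mulrCA ler_wpM2l ?(ltW d0)// mulrC ler_wpM2l ?(ltW t0).
have t2 : 0 < t / 2 by lra.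
have t2t : t / 2 <= t by lra.
have := lip _ t0 (lexx t); have := lip _ t2 t2t.
move: L L0; set W := level q t (4 * u) => L L0; rewrite /level.
set A := Num.min `|u| (t / 2) `^ q; set B := Num.min `|v| (t / 2) `^ q.
set A' := Num.min `|u| t `^ q; set B' := Num.min `|v| t `^ q.
rewrite (_ : A' - A - (B' - B) = A' - B' - (A - B)); last by ring.
move=> H1 H2; apply: le_trans (ler_normB _ _) _.
have qd : 0 < q * d by nra.
have : 0 <= q * d * t `^ q by rewrite mulr_ge0 ?powR_ge0// ltW.
move=> qdt; apply: (@le_trans _ _ (4 * (q * d) * (3 / 4 * t `^ q))); first lra.
by rewrite (mulrA 4 q) ler_wpM2l// -mulrA mulr_ge0// ltW.
Qed.

Lemma sum_level q t u n : 0 < t ->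
  \sum_(k < n) level q (t / 2 ^+ k) u =
  Num.min `|u| t `^ q - Num.min `|u| (t / 2 ^+ n) `^ q.
Proof.
move=> t0; elim: n => [|n IH]; first by rewrite big_ord0 expr0 divr1 subrr.
rewrite big_ord_recr /= IH /level exprS invfM mulrA.
rewrite (_ : t / 2 / 2 ^+ n = t / 2 ^+ n / 2); last by rewrite mulrAC.
ring.
Qed.

(** The constant [2] in place of the optimal [1 / 2] makes [1 + x <= expR x] the
   only fact needed about the exponential. *)
Lemma cosh_le x : (expR x + expR (- x)) / 2 <= expR (2 * x ^+ 2).
Proof.
wlog x0 : x / 0 <= x.
  move=> H; have [|/ltW x0] := leP 0 x; first exact: H.
  by have := H (- x); rewrite opprK sqrrN [expR (- x) + _]addrC; apply; lra.
have [h|h] := leP 2^-1 x.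
  have e1 : expR (- x) <= expR x by rewrite ler_expR; lra.
  have : expR x <= expR (2 * x ^+ 2) by rewrite ler_expR expr2; nra.
  lra.
have e1 := expR_ge1Dx (- x).
have e2 := expR_ge1Dx x.
have E : expR x * expR (- x) = 1 by rewrite expRxMexpNx_1.
have x2 : 0 <= x ^+ 2 by apply: sqr_ge0.
have x24 : x ^+ 2 <= 4^-1 by rewrite expr2; nra.
have a1 : expR x <= (1 - x)^-1.
  by rewrite -ler_pV2 ?inE ?unitfE ?gt_eqF ?expR_gt0 ?invr_gt0 ?subr_gt0 ?invrK//=;
   rewrite -?expRN; lra.
have a2 : expR (- x) <= (1 + x)^-1.
  by rewrite expRN lef_pV2// posrE ?expR_gt0; lra.
apply: (@le_trans _ _ (1 + 2 * x ^+ 2)); last exact: expR_ge1Dx.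
apply: (@le_trans _ _ (((1 - x)^-1 + (1 + x)^-1) / 2)); first lra.
have -> : ((1 - x)^-1 + (1 + x)^-1) / 2 = (1 - x ^+ 2)^-1.
  by field; rewrite -?expr2 !gt_eqF//; nra.
rewrite -div1r ler_pdivrMr; nra.
Qed.

End real_lemmas.

(** * Nets in the uniform norm from Clarkson's inequality *)

Definition lin_closed (R : realType) (T : Type) (V : set (T -> R)) :=
  forall (a b : R) f g, V f -> V g -> V (fun x => a * f x + b * g x).

Section greedy_net.
Variables (R : realType) (I : finType) (q : R).
Implicit Types (f g h : I -> R) (th : seq (I * bool)).

Definition qmean f := #|I|%:R^-1 * \sum_i `|f i| `^ q.

Definition signed_sum th f := \sum_(u <- th) (-1) ^+ u.2 * f u.1.

(** Minimising this over [V] computes, up to sign, the Legendre dual of [qmean] at the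
   functional [eta * signed_sum th]. *)
Definition dual_energy (eta : R) th f := qmean f - eta * signed_sum th f.

Lemma qmean_ge0 f : 0 <= qmean f.
Proof. by rewrite mulr_ge0// sumr_ge0// => i _; apply: powR_ge0. Qed.

Lemma qmean_clarkson f g : 2 <= q ->
  qmean (fun i => (f i + g i) / 2) + qmean (fun i => (f i - g i) / 2)
  <= (qmean f + qmean g) / 2.
Proof.
move=> q2; rewrite /qmean -!mulrDr -mulrA -!big_split /= ler_wpM2l// mulr_suml.
by apply: ler_sum => i _; apply: clarkson_scalar.
Qed.

Variables (V : set (I -> R)) (P t : R).

Definition net_hypotheses := [/\ lin_closed V, 0 < P, 0 < t, 2 <= q &
  forall f, V f -> forall i, `|f i| `^ q <= P * qmean f].

Let eta := (t / 8) `^ (q - 1) / P.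

Let eta_gt0 : 0 < P -> 0 < t -> 0 < eta.
Proof. by move=> P0 t0; rewrite divr_gt0// powR_gt0 ?divr_gt0. Qed.

Let etat : 2 <= q -> 0 < P -> 0 < t -> eta * t = 8 * ((t / 8) `^ q / P).
Proof.
move=> q2 P0 t0; have q0 : 0 < q by lra.
have t8 : 0 <= t / 8 by lra.
by rewrite /eta -(mulr_powRB1 t8 q0); field; rewrite gt_eqF.
Qed.

(** The old near-minimiser [h] is still minimal up to [eta * t / 2] after one more
   vote. Indeed, by Clarkson's inequality, a competitor [g] pays [2 * qmean v] with
   [v := (g - h) / 2], and the vote lets it gain at most [2 * eta * |v i|] relative to
   [h]; the step [eta] is chosen so that the price exceeds the gain when [|v i|]
   is larger than [t / 8]. *)
Lemma dual_energy_step th i (s : bool) h : net_hypotheses -> V h ->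
  (forall g, V g -> dual_energy eta th h <= dual_energy eta th g + eta * t / 8) ->
  forall g, V g -> dual_energy eta th h - eta * (-1) ^+ s * h i - eta * t / 2 <=
    dual_energy eta ((i, s) :: th) g.
Proof.
case=> Vlin P0 t0 q2 Vsup; have eta0 := eta_gt0 P0 t0;
move=> Vh hmin g Vg.
set v := fun i => (g i - h i) / 2.
have Vv : V v.
  rewrite (_ : v = fun i => 2^-1 * g i + - 2^-1 * h i); first exact: Vlin.
  by apply/funext => j; rewrite /v; field.
set m := fun i => (g i + h i) / 2.
have Vm : V m.
  rewrite (_ : m = fun i => 2^-1 * g i + 2^-1 * h i); first exact: Vlin.
  by apply/funext => j; rewrite /m; field.
have := hmin _ Vm; have := qmean_clarkson g h q2; rewrite -/m -/v.
have -> : dual_energy eta ((i, s) :: th) g =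
  dual_energy eta th g - eta * ((-1) ^+ s * (h i + 2 * v i)).
  by rewrite /dual_energy /signed_sum big_cons /= /v; field.
rewrite /dual_energy.
have -> : signed_sum th m = (signed_sum th g + signed_sum th h) / 2.
  rewrite /signed_sum -big_split /= mulr_suml; apply: eq_bigr => u _.
  by rewrite /m; field.
move=> H1 H2.
have key : eta * `|v i| <= qmean v + eta * t / 8.
  have [vt|vt] := leP `|v i| (t / 8).
    rewrite -mulrA ler_wpDl ?qmean_ge0// ler_wpM2l//; exact: ltW.
  have vi : `|v i| `^ q <= P * qmean v by apply: Vsup.
  have : eta * `|v i| <= qmean v.
    rewrite /eta mulrAC ler_pdivrMr// [leRHS]mulrC (le_trans _ vi)//.
    rewrite -[leRHS](@mulr_powRB1 _ `|v i|)//; last lra.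
    rewrite mulrC ler_wpM2l// ler_powR_base//; lra.
  have := mulr_gt0 eta0 t0; lra.
have : eta * ((-1) ^+ s * v i) <= eta * `|v i|.
  rewrite ler_wpM2l ?(ltW eta0)//; apply: le_trans (ler_norm _) _.
  by rewrite normrM normrX normrN1 expr1n mul1r.
lra.
Qed.

(** Only boundedness from below is at stake, and [dual_energy_step] carries it from
   one list of votes to the next. *)
Lemma near_minimizer th f : net_hypotheses -> V f -> exists2 h, V h &
  forall g, V g -> dual_energy eta th h <= dual_energy eta th g + eta * t / 8.
Proof.
move=> hyp; have [Vlin P0 t0 q2 Vsup] := hyp; have eta0 := eta_gt0 P0 t0.
move=> Vf; have et : 0 < eta * t / 8 by rewrite divr_gt0// mulr_gt0.
have inf_attained th' c : (forall g, V g -> c <= dual_energy eta th' g) ->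
    exists2 h, V h & forall g, V g ->
      dual_energy eta th' h <= dual_energy eta th' g + eta * t / 8.
  move=> hc; pose S := dual_energy eta th' @` V.
  have Sinf : has_inf S.
    by split; [exists (dual_energy eta th' f), f|exists c => _ [g Vg <-]; exact: hc].
  have [_ [h Vh <-] hlt] := inf_adherent et Sinf.
  exists h => // g Vg; apply: le_trans (ltW hlt) _; rewrite lerD2r.
  by apply: ge_inf; [case: Sinf|exists g].
elim: th => [|[i s] th [h Vh hmin]].
  apply: (inf_attained _ 0) => g _.
  by rewrite /dual_energy /signed_sum big_nil mulr0 subr0 qmean_ge0.
exact: inf_attained (dual_energy_step i s hyp Vh hmin).
Qed.

(** As long as the near-minimiser [h th] misses [f] by more than [t] at some point,
   a vote for this point, with the sign of the error, lowers
   [dual_energy f - dual_energy (h th)] by at least [eta * t / 2]. This gap starts at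
   [1] or less and never gets below [- (eta * t / 8)], so a good [h th] is found after few votes.
   It is determined by the votes alone, whatever [f] is. *)
Lemma greedy_net (K : nat) : net_hypotheses -> P <= K%:R * (t / 8) `^ q ->
  exists net : K.-tuple (option (I * bool)) -> I -> R,
    forall f, V f -> qmean f <= 1 ->
      exists u, forall i, `|f i - net u i| <= t.
Proof.
move=> hyp; have [Vlin P0 t0 q2 Vsup] := hyp; have eta0 := eta_gt0 P0 t0.
move=> PK.
have [[f0 Vf0]|V0] := pselect (exists f, V f); last first.
  by exists (fun _ _ => 0) => f Vf; case: V0; exists f.
have /choice [h hP] : forall th, exists h, V h /\
  forall g, V g -> dual_energy eta th h <= dual_energy eta th g + eta * t / 8.
  by move=> th; have [h Vh hm] := near_minimizer th hyp Vf0; exists h.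
exists (fun u => h (pmap id u)) => f Vf f1.
have greedy k : (exists2 th, (size th <= k)%N & forall i, `|f i - h th i| <= t) \/
    exists2 th, size th = k &
      dual_energy eta th f - dual_energy eta th (h th) <= 1 - k%:R * (eta * t / 2).
  elim: k => [|k [[th sth hth]|[th sth hth]]].
  - right; exists [::] => //.
    rewrite /dual_energy /signed_sum !big_nil mulr0 mul0r !subr0.
    by have := qmean_ge0 (h [::]); lra.
  - by left; exists th => //; rewrite leqW.
  have [good|/existsNP[i bad]] := pselect (forall i, `|f i - h th i| <= t).
    by left; exists th => //; rewrite sth.
  right; pose s := f i - h th i < 0; exists ((i, s) :: th); first by rewrite /= sth.
  have [Vh hmin] := hP th; have [Vh' _] := hP ((i, s) :: th).
  have := dual_energy_step i s hyp Vh hmin Vh'.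
  set d := dual_energy eta ((i, s) :: th) (h ((i, s) :: th)).
  have -> : dual_energy eta ((i, s) :: th) f =
    dual_energy eta th f - eta * ((-1) ^+ s * f i).
    by rewrite /dual_energy /signed_sum big_cons /=; ring.
  have : eta * t <= eta * ((-1) ^+ s * (f i - h th i)).
    rewrite ler_wpM2l ?(ltW eta0)//.
    suff -> : (-1) ^+ s * (f i - h th i) = `|f i - h th i|.
      by move/negP: bad; rewrite -ltNge => /ltW.
    rewrite /s; case: ltP => z0; first by rewrite expr1 mulN1r ltr0_norm.
    by rewrite expr0 mul1r ger0_norm.
  rewrite -[k.+1%:R]natr1; lra.
have [[th sth hth]|[th sth]] := greedy K; last first.
  have [_ /(_ _ Vf)] := hP th.
  have K0 : (0 < K)%N by case: (K) PK => //; rewrite mul0r; lra.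
  have K1 : 1 <= K%:R :> R by rewrite ler1n.
  have x0 : 0 < (t / 8) `^ q / P by rewrite divr_gt0// powR_gt0 ?divr_gt0.
  have : 1 <= K%:R * ((t / 8) `^ q / P) by rewrite mulrA ler_pdivlMr// mul1r.
  rewrite etat//; move: x0; set x := (_ / P) => x0 Kx.
  have : x <= K%:R * x by rewrite ler_peMl// ltW.
  by rewrite [K%:R * (8 * x / 2)](_ : _ = 4 * (K%:R * x)); [lra|field].
(* Shorter lists of votes are padded with abstentions. *)
have sz : size (map Some th ++ nseq (K - size th) None) == K.
  by rewrite size_cat size_map size_nseq subnKC.
exists (Tuple sz) => i /=; rewrite pmap_cat.
have -> : pmap id (nseq (K - size th) (@None (I * bool))) = [::] by elim: (K - _)%N.
by rewrite cats0 (_ : pmap id (map Some th) = th)//; elim: (th) => //= a l ->.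
Qed.

End greedy_net.

(** * Random signs *)

Section random_signs.
Variables (R : realType) (n : nat).
Implicit Types (a : 'I_n -> R) (e : {ffun 'I_n -> bool}).

Definition rademacher_sum a e := \sum_j (-1) ^+ e j * a j.

Lemma rademacher_sumN a e : rademacher_sum (fun j => - a j) e = - rademacher_sum a e.
Proof. by rewrite -sumrN; apply: eq_bigr => j _; rewrite mulrN. Qed.

Lemma rademacher_mgf (s : R) a :
  \sum_e expR (s * rademacher_sum a e)
  <= 2 ^+ n * expR (2 * s ^+ 2 * \sum_j a j ^+ 2).
Proof.
have -> : \sum_e expR (s * rademacher_sum a e) =
    \prod_j \sum_(b : bool) expR ((-1) ^+ b * (s * a j)).
  rewrite bigA_distr_bigA /=; apply: eq_bigr => e _.
  rewrite -expR_sum mulr_sumr; congr expR; apply: eq_bigr => j _.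
  by rewrite mulrCA.
have -> : 2 ^+ n * expR (2 * s ^+ 2 * \sum_j a j ^+ 2) =
    \prod_(j < n) (2 * expR (2 * (s * a j) ^+ 2)).
  rewrite big_split /= prodr_const card_ord -expR_sum mulr_sumr.
  by congr (_ * _); congr expR; apply: eq_bigr => j _; ring.
apply: ler_prod => j _; rewrite big_bool /= expr1 expr0 mulN1r mul1r.
rewrite addr_ge0 ?expR_ge0//=.
by rewrite [leRHS]mulrC -ler_pdivrMr// addrC cosh_le.
Qed.

(** Chernoff's method at the optimal [s := lam / (4 * W)]. *)
Lemma rademacher_tail a (W lam : R) : 0 < W -> 0 <= lam -> \sum_j a j ^+ 2 <= W ->
  \sum_(e | lam < `|rademacher_sum a e|) 1 <=
  2 ^+ n * (2 * expR (- (lam ^+ 2 / (8 * W)))).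
Proof.
move=> W0 lam0 aW; pose s := lam / (4 * W).
have s0 : 0 <= s by rewrite divr_ge0// mulr_ge0// ltW.
have bound b : \sum_j b j ^+ 2 <= W ->
    \sum_e expR (s * (rademacher_sum b e - lam))
    <= 2 ^+ n * expR (- (lam ^+ 2 / (8 * W))).
  move=> bW; have -> : \sum_e expR (s * (rademacher_sum b e - lam)) =
      (\sum_e expR (s * rademacher_sum b e)) * expR (- (s * lam)).
    by rewrite mulr_suml; apply: eq_bigr => e _; rewrite mulrBr expRD.
  apply: le_trans (ler_wpM2r (expR_ge0 _) (rademacher_mgf s b)) _.
  rewrite -[leLHS]mulrA -expRD ler_wpM2l ?exprn_ge0// ler_expR.
  apply: (@le_trans _ _ (2 * s ^+ 2 * W - s * lam)).
    by rewrite lerD2r ler_wpM2l// mulr_ge0// sqr_ge0.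
  by rewrite le_eqVlt; apply/orP; left; apply/eqP; rewrite /s; field; rewrite gt_eqF.
have aN : \sum_j (- a j) ^+ 2 <= W by under eq_bigr do rewrite sqrrN.
have := lerD (bound _ aW) (bound _ aN).
rewrite -mulrDr -[expR _ + expR _]mulr2n -[expR _ *+ 2]mulr_natl => /(le_trans _); apply.
rewrite -big_split /= [leLHS]big_mkcond /=; apply: ler_sum => e _.
rewrite rademacher_sumN; case: ifPn => [h|_]; last by rewrite addr_ge0 ?expR_ge0.
have [r0|r0] := leP 0 (rademacher_sum a e).
  rewrite ler_wpDr ?expR_ge0//; apply: le_trans (expR_ge1Dx _).
  by move: h; rewrite ger0_norm// => h; rewrite lerDl mulr_ge0// subr_ge0 ltW.
rewrite ler_wpDl ?expR_ge0//; apply: le_trans (expR_ge1Dx _).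
by move: h; rewrite ltr0_norm// => h; rewrite lerDl mulr_ge0// subr_ge0 ltW.
Qed.

(** Union bound. The tests form a family of finite families, and only those whose
   variance is at most the [W] of their family are to be passed. *)
Lemma exists_good_signs (L : nat) (T : 'I_L -> finType)
    (a : forall k, T k -> 'I_n -> R) (W : 'I_L -> R) (lam : R) :
  0 <= lam -> (forall k, 0 < W k) ->
  \sum_k #|T k|%:R * (2 * expR (- (lam ^+ 2 / (8 * W k)))) < 1 ->
  exists e, forall k (u : T k), \sum_j a k u j ^+ 2 <= W k ->
    `|rademacher_sum (a k u) e| <= lam.
Proof.
move=> lam0 W0 small; apply: contrapT => bad.
pose B k u e := (\sum_j a k u j ^+ 2 <= W k) && (lam < `|rademacher_sum (a k u) e|).
have {}bad e : exists k, exists u, B k u e.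
  apply: contrapT => nb; apply: bad; exists e => k u aW.
  by rewrite leNgt; apply/negP => h; apply: nb; exists k, u; rewrite /B aW h.
have : (2 ^+ n : R) <= \sum_e \sum_k \sum_(u : T k) (B k u e)%:R.
  have <- : \sum_(e : {ffun 'I_n -> bool}) (1 : R) = 2 ^+ n.
    by rewrite sumr_const card_ffun card_bool card_ord natrX.
  apply: ler_sum => e _; have [k [u Bu]] := bad e.
  rewrite (bigD1 k)//= (bigD1 u)//= Bu -addrA lerDl addr_ge0// sumr_ge0// => *.
  by rewrite sumr_ge0.
rewrite exchange_big /= => H.
have : (2 ^+ n : R) * 1 <= 2 ^+ n * \sum_k #|T k|%:R * (2 * expR (- (lam ^+ 2 / (8 * W k)))).
  rewrite mulr1; apply: le_trans H _; rewrite mulr_sumr; apply: ler_sum => k _.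
  have -> : 2 ^+ n * (#|T k|%:R * (2 * expR (- (lam ^+ 2 / (8 * W k))))) =
      \sum_(u : T k) 2 ^+ n * (2 * expR (- (lam ^+ 2 / (8 * W k)))).
    by rewrite sumr_const [LHS]mulrCA [LHS]mulr_natl.
  rewrite exchange_big /=; apply: ler_sum => u _.
  have [aW|aW] := boolP (\sum_j a k u j ^+ 2 <= W k); last first.
    rewrite big1 ?mulr_ge0 ?exprn_ge0 ?expR_ge0// => e _.
    by rewrite /B (negbTE aW).
  apply: le_trans (rademacher_tail (W0 k) lam0 aW).
  rewrite [leRHS]big_mkcond /=; apply: ler_sum => e _; rewrite /B aW /=.
  by case: ifP.
by rewrite ler_pM2l ?exprn_gt0// leNgt small.
Qed.

End random_signs.

(** * Keeping one point of each pair *)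

Section halving.
Variables (R : realType) (n : nat) (q : R).
Local Notation I := ('I_n * bool)%type.
Implicit Types (f g D : I -> R) (e : {ffun 'I_n -> bool}).

Definition pair_diff D (j : 'I_n) := D (j, false) - D (j, true).

Lemma sum_pairs D : \sum_i D i = \sum_j (D (j, false) + D (j, true)).
Proof.
rewrite (eq_bigr (fun i : I => D (i.1, i.2))); last by case.
rewrite -(pair_bigA _ (fun j b => D (j, b))) /=.
by apply: eq_bigr => j _; rewrite big_bool addrC.
Qed.

Lemma rademacher_pair_le D e : `|rademacher_sum (pair_diff D) e| <= \sum_i `|D i|.
Proof.
rewrite sum_pairs; apply: le_trans (ler_norm_sum _ _ _) _; apply: ler_sum => j _.
by rewrite normrM normrX normrN1 expr1n mul1r; apply: ler_normB.
Qed.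

Lemma rademacher_pairD D D' e :
  rademacher_sum (pair_diff (fun i => D i + D' i)) e =
  rademacher_sum (pair_diff D) e + rademacher_sum (pair_diff D') e.
Proof. by rewrite -big_split /=; apply: eq_bigr => j _; rewrite /pair_diff; ring. Qed.

Lemma rademacher_pair_sum (L : nat) (D : 'I_L -> I -> R) e :
  rademacher_sum (pair_diff (fun i => \sum_k D k i)) e =
  \sum_k rademacher_sum (pair_diff (D k)) e.
Proof.
rewrite exchange_big; apply: eq_bigr => j _.
by rewrite /pair_diff -sumrB mulr_sumr.
Qed.

Lemma half_sub_qmean D e : (0 < n)%N ->
  n%:R^-1 * (\sum_j D (j, e j)) - #|{: I}|%:R^-1 * \sum_i D i =
  (2 * n%:R)^-1 * rademacher_sum (pair_diff D) e.
Proof.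
move=> n0; have nR : n%:R != 0 :> R by rewrite pnatr_eq0 -lt0n.
rewrite card_prod card_ord card_bool natrM sum_pairs.
have -> : \sum_j D (j, e j) =
    2^-1 * (\sum_j (D (j, false) + D (j, true)) + rademacher_sum (pair_diff D) e).
  rewrite -big_split mulr_sumr; apply: eq_bigr => j _ /=; rewrite /pair_diff.
  by case: (e j); rewrite ?expr1 ?expr0; field.
by field.
Qed.

Lemma sum_level_le (t u : R) (L : nat) : 0 <= q -> 0 < t ->
  \sum_(k < L) level q (t / 2 ^+ k) u <= `|u| `^ q.
Proof.
move=> q0 t0; rewrite sum_level// lerBlDr.
have : Num.min `|u| t `^ q <= `|u| `^ q.
  by rewrite ler_powR_base ?ge_min ?lexx// le_min normr_ge0 ltW.
by have := powR_ge0 (Num.min `|u| (t / 2 ^+ L)) q; lra.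
Qed.

(** Cut [|f| ^ q] into its layers, and on the layer of height [t / 2 ^ k] exchange
   [f] for its approximation [g k]. By [level_approx] the exchange costs, at each
   point, a telescoping sum below [4 * q * d * |4 f| ^ q]. *)
Lemma halving_error (L : nat) (t d lam : R) f (g : 'I_L -> I -> R) e :
  2 <= q -> 0 < t -> 0 < d <= 4^-1 ->
  (forall i, `|f i| <= t) ->
  (forall (k : 'I_L) i, `|f i - g k i| <= d * (t / 2 ^+ k)) ->
  (forall k : 'I_L, `|rademacher_sum
     (pair_diff (fun i => level q (t / 2 ^+ k) (g k i))) e| <= lam) ->
  `|rademacher_sum (pair_diff (fun i => `|f i| `^ q)) e| <=
  L%:R * lam + 4 * q * d * 4 `^ q * (\sum_i `|f i| `^ q)
  + 2 * n%:R * (t / 2 ^+ L) `^ q.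
Proof.
move=> q2 t0 d01 ft fg rad; have q0 : 0 <= q by lra.
have tk k : 0 < t / 2 ^+ k by rewrite divr_gt0// exprn_gt0.
pose E i := \sum_(k < L) (level q (t / 2 ^+ k) (f i) - level q (t / 2 ^+ k) (g k i))
  + Num.min `|f i| (t / 2 ^+ L) `^ q.
have -> : (fun i => `|f i| `^ q) =
    fun i => (\sum_(k < L) level q (t / 2 ^+ k) (g k i)) + E i.
  apply/funext => i; rewrite /E addrA -big_split /=.
  under eq_bigr do rewrite subrKC.
  by rewrite sum_level// (min_l (ft i)) subrK.
rewrite rademacher_pairD rademacher_pair_sum.
apply: le_trans (ler_normD _ _) _; rewrite -addrA; apply: lerD.
  apply: le_trans (ler_norm_sum _ _ _) _.
  have -> : L%:R * lam = \sum_(k < L) lam by rewrite sumr_const card_ord mulr_natl.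
  by apply: ler_sum => k _; apply: rad.
apply: le_trans (rademacher_pair_le _ _) _.
have -> : 2 * n%:R * (t / 2 ^+ L) `^ q = \sum_(i : I) (t / 2 ^+ L) `^ q.
  by rewrite sumr_const card_prod card_ord card_bool -[RHS]mulr_natl natrM (mulrC n%:R).
rewrite mulr_sumr -big_split /=; apply: ler_sum => i _.
apply: le_trans (ler_normD _ _) _; apply: lerD; last first.
  rewrite ger0_norm ?powR_ge0// ler_powR_base ?ge_min ?lexx ?orbT//.
  by rewrite le_min normr_ge0 ltW.
apply: le_trans (ler_norm_sum _ _ _) _.
apply: (@le_trans _ _ (4 * q * d * \sum_(k < L) level q (t / 2 ^+ k) (4 * f i))).
  rewrite mulr_sumr; apply: ler_sum => k _.
  by have [] := level_approx q2 (tk k) d01 (fg k i).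
have /andP[d0 _] := d01.
rewrite -(mulrA _ (4 `^ q)) ler_wpM2l ?mulr_ge0 ?(ltW d0)//.
apply: le_trans (sum_level_le _ _ q0 t0) _.
by rewrite normrM powRM// ger0_norm.
Qed.

(** A layer is at most [t ^ q], so its second moment is at most [t ^ q] times its
   first moment. *)
Lemma level_variance (t d : R) f g : 2 <= q -> 0 < t -> 0 < d <= 4^-1 ->
  (forall i, `|f i - g i| <= d * t) ->
  \sum_j pair_diff (fun i => level q t (g i)) j ^+ 2 <=
  t `^ q * (2 * 4 `^ q * \sum_i `|f i| `^ q).
Proof.
move=> q2 t0 d01 fg; have q0 : 0 <= q by lra.
apply: (@le_trans _ _ (\sum_i level q t (g i) ^+ 2)).
  rewrite sum_pairs; apply: ler_sum => j _; rewrite /pair_diff.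
  have := level_ge0 (g (j, false)) t0 q0; have := level_ge0 (g (j, true)) t0 q0.
  by move: (level _ _ _) (level _ _ _) => a b a0 b0; rewrite !expr2; nra.
rewrite mulrA !mulr_sumr; apply: ler_sum => i _.
have [H _] := level_approx q2 t0 d01 (fg i).
have u1 := sum_level_le (4 * f i) 1 q0 t0.
rewrite big_ord1 expr0 divr1 normrM powRM// [`|4|]ger0_norm// in u1.
rewrite expr2 -!mulrA; apply: ler_pM; rewrite ?level_ge0 ?level_le//.
by apply: le_trans H _; rewrite ler_wpM2l.
Qed.

End halving.

(** * One halving for all functions at once *)

Section halving_step.
Variable R : realType.

Lemma ln2_ge_half : 2^-1 <= ln 2 :> R.
Proof.
rewrite -ler_expR lnK ?posrE// -[2^-1]opprK expRN -[leRHS]invrK.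
by rewrite lef_pV2 ?posrE ?expR_gt0 ?invr_gt0// (le_trans _ (expR_ge1Dx _))//; lra.
Qed.

Lemma ln_ge1 (x : R) : 4 <= x -> 1 <= ln x.
Proof.
move=> x4; have : ln 4 <= ln x by rewrite ler_ln// posrE; lra.
have -> : (4 : R) = 2 ^+ 2 by rewrite expr2; lra.
by rewrite lnXn// -[ln 2 *+ 2]mulr_natl; have := ln2_ge_half; lra.
Qed.

Lemma powR_ge1 (a q : R) : 1 <= a -> 0 <= q -> 1 <= a `^ q.
Proof. by move=> a1 q0; rewrite -[leLHS](powRr0 a) ler_powR. Qed.

Lemma powR_exprn (a q : R) (i : nat) : 0 <= a -> (a ^+ i) `^ q = (a `^ q) ^+ i.
Proof. by move=> a0; rewrite -powR_mulrn// powRAC powR_mulrn// powR_ge0. Qed.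

Lemma powRVl (a q : R) : 0 <= a -> (a^-1) `^ q = (a `^ q)^-1.
Proof. by move=> a0; rewrite -[a^-1]powR_inv1// powRAC powR_inv1// powR_ge0. Qed.

(** [L] levels reach down to values so small that they contribute a multiple of
   [1 / n] to the mean. *)
Lemma level_count (n : nat) : (0 < n)%N -> exists L : nat,
  [/\ (n < 2 ^ L)%N, (L <= 2 * n)%N & L%:R <= 2 * ln (4 * n%:R + 1) :> R].
Proof.
move=> n0; exists (trunc_log 2 n).+1.
have h := trunc_logP (erefl : (1 < 2)%N) n0.
split; first exact: trunc_log_ltn.
  by have := ltn_expl (trunc_log 2 n) (erefl : (1 < 2)%N); lia.
have h' : 2 ^+ (trunc_log 2 n).+1 <= 4 * n%:R + 1 :> R.
  rewrite exprS; have : ((2 ^ trunc_log 2 n)%:R <= n%:R :> R) by rewrite ler_nat.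
  by rewrite natrX; have : (0 : R) <= n%:R by []; lra.
have : ln (2 ^+ (trunc_log 2 n).+1) <= ln (4 * n%:R + 1) :> R.
  by rewrite ler_ln ?posrE ?exprn_gt0// (lt_le_trans _ h')// exprn_gt0.
rewrite lnXn// -[ln 2 *+ _]mulr_natl; have := ln2_ge_half.
have : (0 : R) <= (trunc_log 2 n).+1%:R by []. nra.
Qed.

(** With [x k := (8 * 2 ^ k / d) ^ q], the size of the net at the scale [2 ^ - k] and the
   probability of a large deviation at this scale are exponentials of multiples
   of the same [x k]. *)
Lemma union_bound_small (n L : nat) (G : R) (x : 'I_L -> R) (K : 'I_L -> nat) :
  (0 < n)%N -> (L <= 2 * n)%N -> G = 4 * ln (4 * n%:R + 1) ->
  (forall k, 1 <= x k) -> (forall k, (K k)%:R <= 2 * x k) ->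
  \sum_k (4 * n + 1)%:R ^+ K k * (2 * expR (- (G * x k))) < 1.
Proof.
move=> n0 Ln -> x1 Kx; set l := ln _.
have n1 : 1 <= n%:R :> R by rewrite ler1n.
have l0 : 0 <= l by rewrite ln_ge0//; lra.
have N0 : (0 : R) < 4 * n%:R + 1 by lra.
have term k : (4 * n + 1)%:R ^+ K k * (2 * expR (- (4 * l * x k))) <=
    2 * (4 * n%:R + 1) ^- 2.
  have -> : (4 * n + 1)%:R ^+ K k = expR ((K k)%:R * l) :> R.
    by rewrite expRM_natl lnK ?posrE// natrD natrM.
  rewrite mulrCA ler_wpM2l// -expRD.
  have -> : (4 * n%:R + 1) ^- 2 = expR (- (2 * l)).
    by rewrite expRN expRM_natl lnK// posrE.
  rewrite ler_expR; have := Kx k; have := x1 k.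
  by move: (x k) ((K k)%:R) => a b *; nra.
apply: le_lt_trans (ler_sum _ (fun k _ => term k)) _.
rewrite sumr_const card_ord -[_ *+ L]mulr_natl mulrA ltr_pdivrMr ?exprn_gt0// mul1r.
have : L%:R <= 2 * n%:R :> R by rewrite -natrM ler_nat.
rewrite expr2; nra.
Qed.

Variables (n : nat) (q P d : R) (V : set ('I_n * bool -> R)).

(** A halving with relative error of order [d] is possible when [n] is at least
   [d ^ - (q + 2)] times this. *)
Definition halving_cost : R := 128 * 32 `^ q * P * ln (4 * n%:R + 1) ^+ 3.

(** The three terms of the error are the deviations of the layers, the exchange of
   [f] for its approximations, and the values that are too small for all
   layers. *)
Lemma halving_step_unit : 2 <= q -> (0 < n)%N -> 1 <= P -> 0 < d <= 4^-1 ->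
  lin_closed V ->
  (forall f, V f -> forall i, `|f i| `^ q <= P * qmean q f) ->
  halving_cost <= n%:R * (d `^ q * d ^+ 2) ->
  exists e : {ffun 'I_n -> bool}, forall f, V f -> qmean q f <= 1 ->
    `|n%:R^-1 * (\sum_j `|f (j, e j)| `^ q) - qmean q f| <= 
      d + 4 * q * d * 4 `^ q + d.
Proof.
move=> q2 n0; have n4E : (n * 2 * 2).+1 = (4 * n + 1)%N by lia.
move=> P1 d01 Vlin Vsup cost; have /andP[d0 d4] := d01.
have q0 : 0 < q by lra.
move: cost; rewrite /halving_cost; set l := ln (4 * n%:R + 1) => cost.
have [L [nL Ln Ll]] := level_count n0.
have n1 : 1 <= n%:R :> R by rewrite ler1n.
have l1 : 1 <= l by apply: ln_ge1; lra.
pose M := P `^ q^-1.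
have MP : M `^ q = P by rewrite -powRrM mulVf ?gt_eqF// powRr1//; lra.
have M0 : 0 < M by apply: powR_gt0; lra.
pose t (k : nat) := M / 2 ^+ k.
have t0 k : 0 < t k by rewrite divr_gt0// exprn_gt0.
have tP k : t k `^ q = P / (2 ^+ k) `^ q.
  by rewrite powRM ?invr_ge0 ?(ltW M0) ?exprn_ge0// MP powRVl ?exprn_ge0.
pose x (k : nat) := (8 * 2 ^+ k / d) `^ q.
have x1 k : 1 <= x k.
  have : 1 <= 8 * 2 ^+ k / d.
    rewrite ler_pdivlMr// mul1r; have : (1 : R) <= 2 ^+ k by rewrite exprn_ege1//; lra.
    by lra.
  by move=> h; apply: powR_ge1 => //; exact: ltW.
pose K (k : nat) := (Num.truncn (x k)).+1.
have x0 k : 0 <= x k by apply: powR_ge0.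
have Kx k : (K k)%:R <= 2 * x k.
  have /andP[h _] := truncn_itv (x0 k).
  by rewrite /K -natr1; have := x1 k; lra.
have nets (k : 'I_L) : exists net : (K k).-tuple (option ('I_n * bool * bool)) -> 'I_n * bool -> R,
    forall f, V f -> qmean q f <= 1 -> exists u, forall i, `|f i - net u i| <= d * t k.
  apply: (@greedy_net R _ q V P (d * t k) (K k)).
    by split=> //; [lra|rewrite mulr_gt0].
  apply: (@le_trans _ _ (x k * (d * t k / 8) `^ q)); last first.
    by rewrite ler_wpM2r ?powR_ge0// ltW// truncnS_gt.
  rewrite -powRM ?divr_ge0 ?mulr_ge0 ?exprn_ge0 ?(ltW d0) ?(ltW M0)//.
  rewrite [8 * _ / d * _](_ : _ = M) ?MP// /t; field.
  by rewrite gt_eqF//= gt_eqF// exprn_gt0.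
pose net (k : 'I_L) := projT1 (cid (nets k)).
have netP k f : V f -> qmean q f <= 1 -> exists u, forall i, `|f i - net k u i| <= d * t k.
  exact: (projT2 (cid (nets k))) f.
(* [W k] bounds the variances of [level_variance], and [lam] makes the Gaussian
   exponent [lam ^ 2 / (8 * W k)] twice the bound on the logarithm of the net size. *)
pose W (k : 'I_L) := 4 `^ q * (4 * n%:R) * t k `^ q.
have W0 k : 0 < W k by rewrite !mulr_gt0 ?powR_gt0//; lra.
pose G := 4 * l * (8 / d) `^ q.
have G0 : 0 <= G by rewrite !mulr_ge0 ?powR_ge0//; lra.
pose lam := Num.sqrt (32 * 4 `^ q * n%:R * P * G).
have rad0 : 0 <= 32 * 4 `^ q * n%:R * P * G.
  by rewrite !mulr_ge0 ?powR_ge0//; lra.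
have lam2 : lam ^+ 2 = 32 * 4 `^ q * n%:R * P * G by rewrite sqr_sqrtr.
have lamW k : lam ^+ 2 / (8 * W k) = 4 * l * x k.
  have -> : x k = (8 / d) `^ q * (2 ^+ k) `^ q.
    rewrite -powRM ?divr_ge0 ?exprn_ge0 ?(ltW d0)//; congr (_ `^ _); ring.
  rewrite lam2 /W tP /G; field.
  by rewrite !gt_eqF ?powR_gt0 ?exprn_gt0//; lra.
have [|e eP] := @exists_good_signs R n L (fun k => (K k).-tuple (option ('I_n * bool * bool)))
  (fun k u => pair_diff (fun i => level q (t k) (net k u i))) W lam (sqrtr_ge0 _) W0.
  under eq_bigr => k _.
    rewrite lamW card_tuple card_option !card_prod card_ord card_bool.
    rewrite n4E natrX; over.
  exact: (union_bound_small n0 Ln (erefl _)).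
exists e => f Vf f1.
pose u (k : 'I_L) := projT1 (cid (netP k f Vf f1)).
have uP (k : 'I_L) i : `|f i - net k (u k) i| <= d * t k by exact: (projT2 (cid (netP k f Vf f1))).
have N0 : 0 < 2 * n%:R :> R by lra.
have cardI : #|{: 'I_n * bool}|%:R = 2 * n%:R :> R.
  by rewrite card_prod card_ord card_bool natrM mulrC.
set S := \sum_i `|f i| `^ q.
have S0 : 0 <= S by apply: sumr_ge0 => i _; apply: powR_ge0.
have SI : S <= 2 * n%:R.
  by have := f1; rewrite /qmean cardI -/S mulrC ler_pdivrMr// mul1r.
have fM i : `|f i| <= t 0.
  rewrite /t expr0 divr1 -[leLHS](@powRr1 _ `|f i|)// -(@mulfV _ q) ?gt_eqF//.
  rewrite powRrM ler_powR_base ?invr_ge0 ?powR_ge0 ?(ltW q0)//.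
  by apply: le_trans (Vsup _ Vf i) _; rewrite ler_piMr//; lra.
have err := @halving_error R n q L (t 0) d lam f (fun k => net k (u k)) e q2 (t0 0) d01 fM.
rewrite /t expr0 divr1 -/M in err.
have {}err := err uP.
rewrite /qmean (@half_sub_qmean _ _ (fun i => `|f i| `^ q))//.
rewrite normrM ger0_norm ?invr_ge0 ?(ltW N0)//.
rewrite mulrC ler_pdivrMr//.
apply: le_trans (err _) _.
  move=> k; apply: eP; apply: le_trans (level_variance q2 (t0 k) d01 (uP k)) _.
  rewrite /W -/S [leRHS]mulrC ler_wpM2l ?powR_ge0//.
  by have := powR_ge0 4 q; move: (4 `^ q) => a a0; nra.
have d1 : d <= 1 by lra.
have dq1 : d `^ q <= 1 by rewrite -[leRHS](powRr0 d) ger_powR ?d0 ?d1 ?(ltW q0).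
have dq0 : 0 < d `^ q by apply: powR_gt0.
have Pn : P <= n%:R * d.
  have c1 : P <= 128 * 32 `^ q * P * l ^+ 3.
    rewrite mulrAC ler_peMl//; first lra.
    have h1 : (1 : R) <= 32 `^ q by apply: powR_ge1; rewrite ?ler1n ?(ltW q0).
    have h2 : 1 <= l ^+ 3 by rewrite exprn_ege1.
    nra.
  apply: le_trans c1 (le_trans cost _); rewrite ler_wpM2l//.
  by rewrite expr2 mulrA; apply: (@le_trans _ _ (1 * d)); [nra|rewrite mul1r].
have e3 : (M / 2 ^+ L) `^ q <= d.
  have nL' : n%:R <= 2 ^+ L :> R by rewrite -natrX ler_nat ltnW.
  rewrite -/(t L) tP ler_pdivrMr ?powR_gt0 ?exprn_gt0// (le_trans Pn)// mulrC.
  rewrite ler_wpM2l ?(ltW d0)// (le_trans nL')//.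
  by apply: le1r_powR; [apply: exprn_ege1; lra|lra].
have e1 : L%:R * lam <= 2 * n%:R * d.
  rewrite -(@ler_pXn2r _ 2) ?nnegrE ?mulr_ge0 ?sqrtr_ge0 ?(ltW d0)//.
  rewrite exprMn lam2; apply: (@le_trans _ _ ((2 * l) ^+ 2 * (32 * 4 `^ q * n%:R * P * G))).
    by rewrite ler_wpM2r// ler_pXn2r ?nnegrE//; lra.
  have GE : 4 `^ q * G = 4 * l * 32 `^ q / d `^ q.
    rewrite /G powRM ?invr_ge0 ?(ltW d0)// powRVl ?(ltW d0)//.
    rewrite (_ : (32 : R) = 4 * 8); last lra.
    by rewrite powRM//; ring.
  have -> : (2 * l) ^+ 2 * (32 * 4 `^ q * n%:R * P * G) =
      4 * n%:R * (128 * 32 `^ q * P * l ^+ 3) / d `^ q.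
    rewrite (_ : _ * (_ * G) = (2 * l) ^+ 2 * 32 * n%:R * P * (4 `^ q * G)); last by ring.
    by rewrite GE; ring.
  rewrite ler_pdivrMr//.
  have n4 : 0 <= 4 * n%:R :> R by rewrite mulr_ge0.
  apply: le_trans (ler_wpM2l n4 cost) _; rewrite le_eqVlt; apply/orP; left.
  by apply/eqP; ring.
rewrite -/S 2![(_ + _) * (2 * n%:R)]mulrDl; apply: lerD; first apply: lerD.
- by rewrite [leRHS]mulrC.
- by rewrite ler_wpM2l// !mulr_ge0 ?powR_ge0 ?(ltW d0) ?(ltW q0).
- by rewrite [leRHS]mulrC ler_wpM2l// ltW.
Qed.

Definition halving_loss : R := 2 + 4 * q * 4 `^ q.

Lemma halving_step : 2 <= q -> (0 < n)%N -> 1 <= P -> 0 < d <= 4^-1 ->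
  lin_closed V ->
  (forall f, V f -> forall i, `|f i| `^ q <= P * qmean q f) ->
  halving_cost <= n%:R * (d `^ q * d ^+ 2) ->
  exists e : {ffun 'I_n -> bool}, forall f, V f ->
    `|n%:R^-1 * (\sum_j `|f (j, e j)| `^ q) - qmean q f| <=
      halving_loss * d * qmean q f.
Proof.
move=> q2 n0 P1 d01 Vlin Vsup cost; have q0 : 0 < q by lra.
have [e eP] := halving_step_unit q2 n0 P1 d01 Vlin Vsup cost.
exists e => f Vf; have := qmean_ge0 q f; rewrite le_eqVlt => /predU1P[f0|f0].
  have fq0 i : `|f i| `^ q = 0.
    apply/eqP; rewrite eq_le powR_ge0 andbT.
    by apply: le_trans (Vsup _ Vf i) _; rewrite -f0 mulr0.
  by rewrite -f0 mulr0 subr0 big1 ?mulr0 ?normr0.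
pose c := (qmean q f)^-1 `^ q^-1.
have cq : c `^ q = (qmean q f)^-1.
  by rewrite -powRrM mulVf ?gt_eqF// powRr1// invr_ge0 ltW.
have c0 : 0 <= c by apply: powR_ge0.
pose g i := c * f i + 0 * f i.
have Vg : V g by apply: Vlin.
have gq i : `|g i| `^ q = `|f i| `^ q / qmean q f.
  by rewrite /g mul0r addr0 normrM powRM// (ger0_norm c0) cq mulrC.
have qg : qmean q g = qmean q f / qmean q f.
  rewrite {1}/qmean; under eq_bigr do rewrite gq.
  by rewrite -mulr_suml mulrA.
have gf : qmean q g <= 1 by rewrite qg divff// gt_eqF.
have := eP g Vg gf; rewrite qg; under eq_bigr do rewrite gq.
rewrite -mulr_suml mulrA -mulrBl normrM [X in _ * X]gtr0_norm ?invr_gt0//.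
rewrite ler_pdivrMr// => /le_trans; apply; rewrite ler_wpM2r ?(ltW f0)//.
by rewrite /halving_loss; lra.
Qed.

End halving_step.

(** * Repeated halving *)

Section thinning.
Variables (R : realType) (Z : Type) (q : R) (F : set (Z -> R)).
Implicit Types (y : nat -> Z) (f : Z -> R).

Definition emp_mean (n : nat) y f := n%:R^-1 * \sum_(j < n) `|f (y j)| `^ q.

Lemma emp_mean_halving (n : nat) y (P d : R) :
  2 <= q -> (0 < n)%N -> 1 <= P -> 0 < d <= 4^-1 -> lin_closed F ->
  (forall f, F f -> forall j, `|f (y j)| `^ q <= P * emp_mean (n + n) y f) ->
  halving_cost n q P <= n%:R * (d `^ q * d ^+ 2) ->
  exists2 y', (forall j, exists i, y' j = y i) &
    forall f, F f -> `|emp_mean n y' f - emp_mean (n + n) y f| <=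
      halving_loss q * d * emp_mean (n + n) y f.
Proof.
move=> q2 n0 P1 d01 Flin Fsup cost.
pose idx (i : 'I_n * bool) := (i.1 + i.2 * n)%N.
pose V := [set g | exists2 f, F f & g = fun i => f (y (idx i))].
have Vmean f : qmean q (fun i => f (y (idx i))) = emp_mean (n + n) y f.
  rewrite /qmean /emp_mean card_prod card_ord card_bool muln2 -addnn; congr (_ * _).
  rewrite sum_pairs big_split big_split_ord /=; congr (_ + _); apply: eq_bigr => j _.
    by rewrite /idx /= mul0n addn0.
  by rewrite /idx /= mul1n addnC.
have Vlin : lin_closed V.
  move=> a b _ _ [f Ff ->] [g Fg ->]; exists (fun z => a * f z + b * g z) => //.
  exact: Flin.
have Vsup g : V g -> forall i, `|g i| `^ q <= P * qmean q g.
  by move=> [f Ff ->] i; rewrite Vmean; apply: Fsup.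
have [e eP] := halving_step q2 n0 P1 d01 Vlin Vsup cost.
pose y' (j : nat) := if insub j is Some j' then y (idx (j', e j')) else y 0%N.
exists y'.
  move=> j; rewrite /y'; case: insub => [j'|]; first by exists (idx (j', e j')).
  by exists 0%N.
move=> f Ff; have Vf : V (fun i => f (y (idx i))) by exists f.
have := eP _ Vf; rewrite Vmean; congr (`| _ - _ | <= _).
rewrite /emp_mean; congr (_ * _); apply: eq_bigr => j _.
by rewrite /y' valK.
Qed.

Variable (Nq : (Z -> R) -> R) (Om : set Z).

(** [Nq f] is to be thought of as the [q]-th power of the norm of [f]. As long as the
   accumulated relative error is at most [1 / 2], the empirical mean at the points
   in use is at least half of it, so [2 * P] serves in all the halvings. *)
Lemma repeated_halving (m s : nat) (P : R) (d : nat -> R) :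
  2 <= q -> (0 < m)%N -> 1 <= P -> (forall i, 0 < d i <= 4^-1) -> lin_closed F ->
  (forall f, F f -> 0 <= Nq f) ->
  (forall f z, F f -> Om z -> `|f z| `^ q <= P * Nq f) ->
  (forall i, halving_cost (2 ^ i * m) q (2 * P) <=
     (2 ^ i * m)%:R * (d i `^ q * d i ^+ 2)) ->
  forall y (e : R), (forall j, Om (y j)) -> 0 <= e ->
  (forall f, F f -> `|emp_mean (2 ^ s * m) y f - Nq f| <= e * Nq f) ->
  e + 2 * halving_loss q * (\sum_(i < s) d i) <= 2^-1 ->
  exists2 y', (forall j, Om (y' j)) & forall f, F f ->
    `|emp_mean m y' f - Nq f| <=
    (e + 2 * halving_loss q * (\sum_(i < s) d i)) * Nq f.
Proof.
move=> q2 m0 P1 d01 Flin N0 Fsup cost.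
have C0 : 0 <= halving_loss q.
  by rewrite addr_ge0// !mulr_ge0 ?powR_ge0//; lra.
elim: s => [|s IH] y e yOm e0 ye etot.
  exists y => // f Ff; rewrite big_ord0 mulr0 addr0.
  by have := ye f Ff; rewrite expn0 mul1n.
have n0 : (0 < 2 ^ s * m)%N by rewrite muln_gt0 expn_gt0.
have nn : (2 ^ s.+1 * m = 2 ^ s * m + 2 ^ s * m)%N by rewrite expnS; lia.
rewrite nn in ye.
have /andP[ds0 _] := d01 s.
have sum0 : 0 <= \sum_(i < s) d i.
  by apply: sumr_ge0 => i _; have /andP[/ltW] := d01 i.
rewrite big_ord_recr /= in etot *.
have Cs : 0 <= halving_loss q * d s by rewrite mulr_ge0// ltW.
have Cb : 0 <= halving_loss q * (\sum_(i < s) d i) by rewrite mulr_ge0.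
have e2 : e <= 2^-1.
  by move: etot Cs Cb; set a := halving_loss q; set b := \sum_(i < s) _ => *; nra.
have near f : F f -> Nq f <= 2 * emp_mean (2 ^ s * m + 2 ^ s * m) y f /\
    emp_mean (2 ^ s * m + 2 ^ s * m) y f <= 2 * Nq f.
  move=> Ff; have := ye f Ff; rewrite ler_norml => /andP[].
  by have := N0 f Ff; move: (Nq f) (emp_mean _ _ _) => a b *; split; nra.
have [||y1 y1y hy1] := @emp_mean_halving _ y (2 * P) (d s) q2 n0 _ (d01 s) Flin _ (cost s).
- by lra.
- move=> f Ff j; apply: le_trans (Fsup f _ Ff (yOm j)) _.
  by have [+ _] := near f Ff; move: (Nq f) (emp_mean _ _ _) => a b *; nra.
have [||||y' y'Om hy'] := IH y1 (e + 2 * (halving_loss q * d s)).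
- by move=> j; have [i ->] := y1y j.
- by lra.
- move=> f Ff; have [_ +] := near f Ff; have := ye f Ff; have := hy1 f Ff.
  rewrite -/(emp_mean _ _ _).
  set a := emp_mean _ y1 f; set b := emp_mean _ y f; set c := Nq f.
  move=> h1 h2 h3; have -> : a - c = (a - b) + (b - c) by ring.
  apply: le_trans (ler_normD _ _) _.
  have : halving_loss q * d s * b <= halving_loss q * d s * (2 * c) by rewrite ler_wpM2l.
  lra.
- by move: etot; lra.
exists y' => // f Ff; apply: le_trans (hy' f Ff) _.
by rewrite ler_wpM2r ?N0//; lra.
Qed.

End thinning.

Section thinning_constants.
Variable R : realType.

(** Split [2 ^ i] as a product of two equal exponentials: one of them beats the
   cube of the logarithm, the other one will drive the geometric series. *)
Lemma log_growth (i : nat) (m : nat) : (0 < m)%N ->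
  ln (4 * (2 ^ i * m)%:R + 1) ^+ 3 <=
  12 ^+ 3 * expR (ln 2 / 2) ^+ i * ln (4 * m%:R + 1) ^+ 3 :> R.
Proof.
move=> m0; have m1 : 1 <= m%:R :> R by rewrite ler1n.
set l := ln (4 * m%:R + 1); have l1 : 1 <= l by apply: ln_ge1; lra.
have l2 := ln2_ge_half R.
have l2l : ln 2 <= l by rewrite ler_ln// ?posrE; lra.
have p1 : 1 <= 2 ^+ i :> R by rewrite exprn_ege1//; lra.
have h1 : ln (4 * (2 ^ i * m)%:R + 1) <= (1 + i%:R) * l.
  apply: (@le_trans _ _ (ln (2 ^+ i * (4 * m%:R + 1)))).
    have E : 4 * (2 ^ i * m)%:R + 1 <= 2 ^+ i * (4 * m%:R + 1) :> R.
      by rewrite natrM natrX mulrDr mulr1 mulrCA lerD2l.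
    have E0 : (0 : R) < 4 * (2 ^ i * m)%:R + 1 by rewrite ltr_wpDl// mulr_ge0.
    by rewrite ler_ln ?posrE ?(lt_le_trans E0).
  have m4 : (0 : R) < 4 * m%:R + 1 by lra.
  rewrite lnM ?posrE ?exprn_gt0//.
  rewrite lnXn// -/l -[ln 2 *+ i]mulr_natl mulrDl mul1r addrC lerD2l.
  by rewrite ler_wpM2l.
pose v : R := expR (ln 2 / 6).
have v1 : 1 + 12^-1 <= v by apply: le_trans (expR_ge1Dx _); lra.
have h2 : 1 + i%:R <= 12 * v ^+ i.
  elim: i {p1 h1} => [|i IH]; first by rewrite expr0; lra.
  rewrite exprS -[i.+1%:R]natr1; have : 1 <= v ^+ i by rewrite exprn_ege1//; lra.
  by move: (v ^+ i) IH => a *; nra.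
have -> : 12 ^+ 3 * expR (ln 2 / 2) ^+ i * l ^+ 3 = (12 * v ^+ i * l) ^+ 3.
  rewrite (_ : expR (ln 2 / 2) = v ^+ 3); last first.
    by rewrite -expRM_natl; congr expR; field.
  by rewrite exprAC; ring.
rewrite ler_pXn2r ?nnegrE//.
- by apply: le_trans h1 _; rewrite ler_wpM2r//; lra.
- by apply: ln_ge0; have : (0:R) <= (2 ^ i * m)%:R by []; lra.
- by rewrite !mulr_ge0 ?exprn_ge0 ?expR_ge0//; lra.
Qed.

Lemma geometric_sum_le (r : R) (s : nat) : 0 < r < 1 ->
  \sum_(i < s) r ^+ i <= (1 - r)^-1.
Proof.
move=> /andP[r0 r1]; rewrite -div1r ler_pdivlMr ?subr_gt0//.
have -> : (\sum_(i < s) r ^+ i) * (1 - r) = 1 - r ^+ s.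
  elim: s => [|s IH]; first by rewrite big_ord0 mul0r expr0 subrr.
  by rewrite big_ord_recr /= mulrDl IH [r ^+ s.+1]exprS; ring.
by rewrite gerBl exprn_ge0// ltW.
Qed.

(** The relative errors are [d i := d0 * r ^ i] with [r ^ (q + 2) = 2 ^ (- 1 / 2)]: of the
   factor [2 ^ i] by which the number of points exceeds [m], one half of the exponent
   pays for the small [d i] and the other half for the logarithms. *)
Lemma thinning (q eps : R) : 2 <= q -> 0 < eps <= 2^-1 ->
  exists2 C1 : R, 0 < C1 &
  forall (Z : Type) (F : set (Z -> R)) (Nq : (Z -> R) -> R) (Om : set Z)
         (P : R) (m s : nat) (y : nat -> Z),
  lin_closed F ->
  (0 < m)%N -> 1 <= P ->
  (forall f, F f -> 0 <= Nq f) ->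
  (forall f z, F f -> Om z -> `|f z| `^ q <= P * Nq f) ->
  C1 * P * ln (4 * m%:R + 1) ^+ 3 <= m%:R ->
  (forall j, Om (y j)) ->
  (forall f, F f -> `|emp_mean q (2 ^ s * m) y f - Nq f| <= eps / 2 * Nq f) ->
  exists2 y', (forall j, Om (y' j)) & forall f, F f ->
    `|emp_mean q m y' f - Nq f| <= eps * Nq f.
Proof.
move=> q2 /andP[eps0 eps1].
have l2 := ln2_ge_half R.
pose r : R := expR (- (ln 2 / (2 * (q + 2)))).
have r0 : 0 < r by apply: expR_gt0.
have r1 : r < 1 by rewrite expR_lt1 oppr_lt0 divr_gt0//; lra.
pose C2 := halving_loss q.
have C2p : 0 < C2 by rewrite ltr_wpDr// !mulr_ge0 ?powR_ge0//; lra.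
pose d0 := Num.min 4^-1 (eps * (1 - r) / (4 * C2)).
have d0p : 0 < d0.
  by rewrite lt_min; apply/andP; split; [lra|rewrite divr_gt0 ?mulr_gt0//; lra].
have d04 : d0 <= 4^-1 by rewrite ge_min lexx.
have dq : 0 < d0 `^ q * d0 ^+ 2 by rewrite mulr_gt0 ?powR_gt0 ?exprn_gt0.
pose K := 128 * 32 `^ q * 2 * 12 ^+ 3 : R.
have K0 : 0 < K by rewrite !mulr_gt0 ?powR_gt0 ?exprn_gt0 ?ltr0n.
exists (K / (d0 `^ q * d0 ^+ 2)); first by rewrite divr_gt0.
move=> Z F Nq Om P m s y Flin m0 P1 N0 Fsup hm yOm hy.
pose d i := d0 * r ^+ i.
have ri i : 0 < r ^+ i <= 1 by rewrite exprn_gt0//= exprn_ile1// ltW.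
have d01 i : 0 < d i <= 4^-1.
  by have /andP[a b] := ri i; rewrite /d mulr_gt0//=; nra.
have hsum : 2 * C2 * (\sum_(i < s) d i) <= eps / 2.
  rewrite -mulr_sumr; have := @geometric_sum_le r s; rewrite r0 r1 => /(_ erefl).
  set S := \sum_(i < s) _ => hS.
  have h : d0 * S <= d0 * (1 - r)^-1 by rewrite ler_wpM2l// ltW.
  have : d0 <= eps * (1 - r) / (4 * C2) by rewrite ge_min lexx orbT.
  have r10 : 0 < 1 - r by lra.
  rewrite ler_pdivlMr ?mulr_gt0// => h'.
  rewrite -(ler_pM2r r10); apply: (@le_trans _ _ (2 * C2 * (d0 * (1 - r)^-1) * (1 - r))).
    by rewrite ler_wpM2r ?(ltW r10)// ler_wpM2l// mulr_ge0// ltW.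
  rewrite -[X in X <= _]mulrA mulfVK ?gt_eqF//; lra.
have cost i : halving_cost (2 ^ i * m) q (2 * P) <=
    (2 ^ i * m)%:R * (d i `^ q * d i ^+ 2).
  have w0 : 0 < expR (ln 2 / 2) ^+ i :> R by rewrite exprn_gt0// expR_gt0.
  have -> : (2 ^ i * m)%:R * (d i `^ q * d i ^+ 2) =
      m%:R * (d0 `^ q * d0 ^+ 2) * expR (ln 2 / 2) ^+ i.
    have rq : r `^ q * r ^+ 2 * 2 = expR (ln 2 / 2).
      have e2 : expR (ln 2) = 2 :> R by rewrite lnK ?posrE.
      rewrite /r -expRM -expRM_natl -[X in _ * X = _]e2 -!expRD; congr expR.
      by field; lra.
    rewrite /d powRM ?(ltW d0p) ?exprn_ge0 ?(ltW r0)// -rq powR_exprn ?(ltW r0)// !exprMn.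
    by rewrite natrM natrX; ring.
  rewrite /halving_cost.
  apply: (@le_trans _ _ (128 * 32 `^ q * (2 * P) *
      (12 ^+ 3 * expR (ln 2 / 2) ^+ i * ln (4 * m%:R + 1) ^+ 3))).
    by rewrite ler_wpM2l ?log_growth// !mulr_ge0 ?powR_ge0//; lra.
  rewrite (_ : _ * (_ * _ * _) = K * P * ln (4 * m%:R + 1) ^+ 3 * expR (ln 2 / 2) ^+ i).
    rewrite ler_pM2r//; move: hm; rewrite [_ / _ * P]mulrAC [_ / _ * _]mulrAC.
    by rewrite ler_pdivrMr.
  by rewrite /K; ring.
have [||y' y'Om hy'] := repeated_halving q2 m0 P1 d01 Flin N0 Fsup cost yOm _ hy.
- by lra.
- by rewrite -/C2; lra.
exists y' => // f Ff; apply: le_trans (hy' f Ff) _.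
by rewrite ler_wpM2r ?N0// -/C2; lra.
Qed.

End thinning_constants.

(** * A finite discretization of the norm *)

Section continuous_functions.
Variables (R : realType) (d : nat) (Om : set 'rV[R]_d).
Hypothesis Omc : compact Om.

Lemma compact_measurable_rV : measurable (Om : set (borel_rV R d)).
Proof.
have Omcl : closed Om by apply: compact_closed => //; exact: norm_hausdorff.
rewrite -(setCK Om); apply: measurableC; apply: sub_sigma_algebra.
exact: closed_openC.
Qed.

Lemma Ccont_measurable (f : 'rV[R]_d -> R^o) : Ccont Om f ->
  measurable_fun [set: borel_rV R d] (f : borel_rV R d -> R).
Proof.
move=> [/continuousP cf f0]; have mOm := compact_measurable_rV.
apply: (measurability _ (RGenOpens.measurableE R)).
move=> _ [_ [a [b ->] <-]]; rewrite setTI; set U := `]a, b[%classic.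
have /open_subspaceP [W Wo WE] : open (from_subspace Om f @^-1` U).
  by apply: cf; exact: interval_open.
have mW : measurable (W : set (borel_rV R d)) by apply: sub_sigma_algebra.
rewrite (_ : f @^-1` U = (W `&` Om) `|` (f @^-1` U `&` ~` Om)); last first.
  rewrite WE; apply/seteqP; split => [x fx|x [[]//|[]//]].
  by have [Ox|Ox] := pselect (Om x); [left|right].
apply: measurableU; first exact: measurableI.
have [U0|U0] := pselect (U 0).
  rewrite (_ : _ `&` _ = ~` Om); first exact: measurableC.
  by apply/seteqP; split => [x []//|x Ox]; split => //; rewrite /preimage /= f0.
rewrite (_ : _ `&` _ = set0) //; apply/seteqP; split => [x [fx Ox]|//].
by apply: U0; rewrite -(f0 x Ox).
Qed.

Lemma Ccont_le_unif_norm (f : 'rV[R]_d -> R^o) x : Ccont Om f -> Om x ->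
  `|f x| <= unif_norm Om f.
Proof.
move=> [cf _] Ox; apply: sup_upper_bound; last by exists x.
split; first by exists `|f x|, x.
have := continuous_compact cf Omc => /compact_bounded [M [_ Mf]].
exists (M + 1) => _ [z Oz <-]; apply: (Mf (M + 1)); first by rewrite ltrDl.
by exists z.
Qed.

End continuous_functions.

Section finite_dimension.
Variables (R : realType) (T : Type) (N : nat) (u : 'I_N -> T -> R).

Let f (c : 'I_N -> R) x := \sum_i c i * u i x.

Hypothesis free : forall c, (forall x, f c x = 0) -> forall i, c i = 0.

(** Evaluations at suitable points are a basis of the dual: a coefficient vector
   killed by fewer than [N] independent evaluations is detected by another one. *)
Lemma independent_evaluations (k : nat) : (k <= N)%N ->
  exists z : 'I_k -> T, row_free (\matrix_(j < k, i < N) u i (z j)).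
Proof.
elim: k => [|k IH] kN.
  exists (fun j : 'I_0 => match notF (ltn_ord j) with end).
  by rewrite /row_free (flatmx0 (\matrix_(j, i) _)) mxrank0.
have [z zfree] := IH (ltnW kN); set A := \matrix_(j, i) _ in zfree.
have kerA : kermx A^T != 0.
  rewrite kermx_eq0 /row_free mxrank_tr; move: zfree; rewrite /row_free => /eqP ->.
  by rewrite neq_ltn kN.
pose c := nz_row (kermx A^T).
have cA : c *m A^T = 0 by apply/sub_kermxP; apply: nz_row_sub.
have [x fx] : exists x, f (fun i => c 0 i) x != 0.
  apply: contrapT => h; move: kerA; rewrite -nz_row_eq0 -/c => /eqP; apply.
  apply/rowP => i; rewrite mxE; apply: (free (c := fun i => c 0 i)) => x.
  by apply/eqP; apply: contrapT => fx; apply: h; exists x; apply/negP.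
pose b : 'rV[R]_N := \row_i u i x.
pose z' (j : 'I_k.+1) := if unlift ord0 j is Some j' then z j' else x.
exists z'.
have -> : (\matrix_(j < k.+1, i < N) u i (z' j)) = (col_mx b A : 'M[R]_(1 + k, N)).
  apply/matrixP => j i; rewrite [LHS]mxE [RHS]mxE.
  case: (@fintype.splitP 1 k j) => j'.
    rewrite (ord1 j') => jE; rewrite /b mxE /z'; case: unliftP => [w jw|//].
    by move: jE; rewrite jw.
  move=> jE; rewrite /A mxE /z'; case: unliftP => [w jw|j0].
    by congr (u i (z _)); apply: val_inj; move: jE; rewrite jw /= /bump add1n => -[].
  by move: jE; rewrite j0.
rewrite /row_free eqn_leq rank_leq_row /= -(addsmxE b A).1.
have : (A < b + A)%MS.
  rewrite /ltmx addsmxSr /=; apply/negP => h.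
  have /submxP [w bE] : (b <= A)%MS by apply: submx_trans h; apply: addsmxSl.
  have cb : b *m c^T = 0.
    by rewrite bE -mulmxA -[A *m _]trmxK trmx_mul trmxK cA trmx0 mulmx0.
  have fE : f (fun i => c 0 i) x = (b *m c^T) 0 0.
    by rewrite mxE; apply: eq_bigr => i _; rewrite !mxE mulrC.
  by move: fx; rewrite fE cb mxE eqxx.
by move=> /rank_ltmx; move: zfree; rewrite /row_free => /eqP ->.
Qed.

(** Invert the matrix of the evaluations at [N] independent points. *)
Lemma coefficients_le_sup : exists2 K : R, 0 <= K &
  forall c b, (forall x, `|f c x| <= b) -> \sum_i `|c i| <= K * b.
Proof.
have [z zfree] := independent_evaluations (leqnn N).
set A := \matrix_(j, i) _ in zfree.
have Aunit : A \in unitmx by rewrite -row_free_unit.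
exists (\sum_i \sum_j `|invmx A i j|); first by do 2 apply: sumr_ge0 => *.
move=> c b fb; rewrite mulr_suml; apply: ler_sum => i _.
have -> : c i = \sum_j invmx A i j * f c (z j).
  have -> : c i = (invmx A *m (A *m (\col_i c i))) i 0.
    by rewrite mulmxA mulVmx// mul1mx mxE.
  rewrite mxE; apply: eq_bigr => j _; congr (_ * _); rewrite mxE.
  by apply: eq_bigr => l _; rewrite !mxE mulrC.
apply: le_trans (ler_norm_sum _ _ _) _; rewrite mulr_suml.
by apply: ler_sum => j _; rewrite normrM ler_wpM2l.
Qed.

End finite_dimension.

Section partition.
Context {d : measure_display} {T : measurableType d} {R : realType}.

(** The cells are the preimages of the cubes of side [dl] under [u]. *)
Lemma finite_measurable_partition (N : nat) (u : 'I_N -> T -> R) (K dl : R) :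
  0 < dl -> (forall i, measurable_fun setT (u i)) ->
  (forall i x, `|u i x| <= K) ->
  exists (J : finType) (c : T -> J),
    (forall j, measurable (c @^-1` [set j])) /\
    forall x y, c x = c y -> forall i, `|u i x - u i y| <= dl.
Proof.
move=> dl0 mu uK; pose w i x := (u i x + K) / dl.
have w0 i x : 0 <= w i x.
  rewrite divr_ge0 ?(ltW dl0)//; have := uK i x; rewrite ler_norml => /andP[h _].
  by rewrite -lerBlDr sub0r.
pose n := Num.truncn ((K + K) / dl).
have wn i x : (Num.truncn (w i x) < n.+1)%N.
  rewrite ltnS; apply: le_truncn; rewrite ler_wpM2r ?invr_ge0 ?(ltW dl0)// lerD2r.
  by apply: le_trans (ler_norm _) (uK i x).
pose c x : {ffun 'I_N -> 'I_n.+1} := [ffun i => inord (Num.truncn (w i x))].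
exists _, c; split => [j|x y cxy i].
  rewrite (_ : _ @^-1` _ =
      \bigcap_(i in [set: 'I_N]) (w i @^-1` `[(j i)%:R, (j i).+1%:R[%classic)).
    apply: fin_bigcap_measurable => // i _.
    have mw : measurable_fun setT (w i).
      by apply: measurable_funM => //; apply: measurable_funD.
    by rewrite -[X in measurable X]setTI; apply: mw.
  apply/seteqP; split => [x /= cx i _|x /= cx].
    rewrite /preimage /= in_itv /= -truncn_eq//.
    by rewrite -cx ffunE inordK.
  apply/ffunP => i; apply: val_inj; rewrite ffunE /= inordK//.
  by apply/eqP; rewrite truncn_eq//; have := cx i I; rewrite /preimage /= in_itv.
have := congr1 (fun g : {ffun 'I_N -> 'I_n.+1} => val (g i)) cxy.
rewrite !ffunE /= !inordK// => E.
have /andP[a1 a2] := truncn_itv (w0 i x); have /andP[b1 b2] := truncn_itv (w0 i y).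
rewrite E in a1 a2; set k := (Num.truncn _)%:R in a1 b1.
have k1 : (Num.truncn (w i y)).+1%:R = k + 1 by rewrite -natr1.
rewrite k1 in a2 b2.
have -> : u i x - u i y = dl * (w i x - w i y).
  by rewrite /w; field; rewrite gt_eqF.
rewrite normrM (gtr0_norm dl0) ler_piMr ?(ltW dl0)// ler_norml.
by move: (w i x) (w i y) a1 a2 b1 b2 => *; apply/andP; split; lra.
Qed.

End partition.

(** Give [j] the multiplicity [floor (n * p j)]; the default value [j0] of the list of
   these points completes it to [n] points. *)
Lemma rational_weights (R : realType) (J : finType) (j0 : J) (p : J -> R) (n : nat) :
  (forall j, 0 <= p j) -> \sum_j p j = 1 ->
  exists c : nat -> J, forall (g : J -> R) G, (forall j, 0 <= g j <= G) ->
    `|\sum_(k < n) g (c k) - n%:R * \sum_j p j * g j| <= (2 * #|J|)%:R * G.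
Proof.
move=> p0 p1; pose a j := Num.truncn (n%:R * p j).
have np0 j : 0 <= n%:R * p j by rewrite mulr_ge0.
have aP j : (a j)%:R <= n%:R * p j < (a j)%:R + 1.
  by have := truncn_itv (np0 j); rewrite -natr1.
pose s := flatten [seq nseq (a j) j | j <- enum J].
have sumE (h : J -> R) : \sum_(j <- s) h j = \sum_j (a j)%:R * h j.
  rewrite big_flatten big_map /= big_enum /=; apply: eq_bigr => j _.
  by rewrite big_nseq iter_addr_0 mulr_natl.
have sizeE : (size s)%:R = \sum_j (a j)%:R :> R.
  have -> : (size s)%:R = \sum_(j <- s) 1 :> R by rewrite -sum1_size natr_sum.
  by rewrite (sumE (fun=> 1)); apply: eq_bigr => j _; rewrite mulr1.
have [r0 r1] : 0 <= n%:R - (size s)%:R :> R /\ n%:R - (size s)%:R <= #|J|%:R :> R.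
  have -> : n%:R - (size s)%:R = \sum_j (n%:R * p j - (a j)%:R).
    by rewrite sumrB -mulr_sumr p1 mulr1 sizeE.
  split.
    by apply: sumr_ge0 => j _; rewrite subr_ge0; case/andP: (aP j).
  rewrite -sum1_card natr_sum; apply: ler_sum => j _.
  by case/andP: (aP j) => _ /ltW; rewrite lerBlDr addrC.
have sn : (size s <= n)%N by rewrite -(ler_nat R) -subr_ge0.
exists (nth j0 s) => g G gG.
have -> : \sum_(k < n) g (nth j0 s k) =
    \sum_j (a j)%:R * g j + (n%:R - (size s)%:R) * g j0.
  rewrite -sumE -(big_mkord predT (fun k => g (nth j0 s k))).
  rewrite (big_cat_nat _ sn)//=; congr (_ + _).
    by rewrite -(big_nth j0 predT g).
  rewrite (eq_big_nat _ _ (F2 := fun=> g j0)) => [|k /andP[h _]].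
    by rewrite sumr_const_nat -natrB// mulr_natl.
  by rewrite nth_default.
have G0 : 0 <= G by have /andP[] := gG j0; apply: le_trans.
have -> : (2 * #|J|)%:R * G = \sum_(j : J) G + #|J|%:R * G.
  by rewrite sumr_const -mulr_natl natrM; ring.
rewrite addrAC; apply: le_trans (ler_normD _ _) _; apply: lerD.
  rewrite mulr_sumr -sumrB; apply: le_trans (ler_norm_sum _ _ _) _.
  apply: ler_sum => j _; rewrite mulrA -mulrBl normrM.
  have /andP[g0 gG'] := gG j; rewrite (ger0_norm g0).
  rewrite -[leRHS]mul1r ler_pM// ler_norml.
  by have /andP[h1 h2] := aP j; apply/andP; split; lra.
have /andP[g0 gG'] := gG j0.
by rewrite normrM (ger0_norm g0) (ger0_norm r0) ler_pM.
Qed.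

Section step_integral.
Context {d : measure_display} {T : measurableType d} {R : realType}.
Variables (mu : probability T R) (Om : set T) (J : finType) (c : T -> J).
Hypothesis mOm : measurable Om.
Hypothesis muOm : mu Om = 1%E.
Hypothesis mc : forall j, measurable (c @^-1` [set j]).

Let A j := Om `&` (c @^-1` [set j]).

Let mA j : measurable (A j).
Proof. exact: measurableI. Qed.

Definition cell_mass j := fine (mu (A j)).

Lemma cell_mass_ge0 j : 0 <= cell_mass j.
Proof. by rewrite fine_ge0. Qed.

Let step (v : J -> R) x := \sum_j v j * \1_(A j) x.

Lemma step_in v x : Om x -> step v x = v (c x).
Proof.
move=> Ox; rewrite /step (bigD1 (c x))//= indicE mem_set ?mulr1; last by split.
rewrite big1 ?addr0// => j jx; rewrite indicE memNset ?mulr0//.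
by move=> [_ /=] E; rewrite E eqxx in jx.
Qed.

Lemma step_out v x : ~ Om x -> step v x = 0.
Proof.
by move=> Ox; rewrite /step big1// => j _; rewrite indicE memNset ?mulr0// => -[].
Qed.

Lemma measurable_step v : measurable_fun setT (fun x => (step v x)%:E).
Proof.
apply/measurable_EFinP; apply: measurable_sum => j.
by apply: measurable_funM => //; apply: measurable_indic.
Qed.

Lemma integral_step v : (forall j, 0 <= v j) ->
  (\int[mu]_x (step v x)%:E = (\sum_j v j * cell_mass j)%:E)%E.
Proof.
move=> v0; under eq_integral do rewrite /step -sumEFin.
rewrite ge0_integral_sum//; last 2 first.
- move=> j; apply/measurable_EFinP.
  by apply: measurable_funM => //; apply: measurable_indic.
- by move=> j x _; rewrite lee_fin mulr_ge0.
rewrite -sumEFin; apply: eq_bigr => j _.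
under eq_integral do rewrite EFinM.
rewrite ge0_integralZl// ?lee_fin//; last first.
  by apply/measurable_EFinP; apply: measurable_indic.
rewrite integral_indic// setIT EFinM /cell_mass fineK//.
exact: fin_num_measure.
Qed.

Lemma sum_cell_mass : \sum_j cell_mass j = 1.
Proof.
have := integral_step (fun _ => ler01).
under eq_bigr do rewrite mul1r.
rewrite (_ : (\int[mu]_x _)%E = 1%E) => [|]; first by move=> [].
rewrite -muOm -[in RHS](setIT Om) -integral_indic//; apply: eq_integral => x _.
congr EFin; rewrite indicE; have [Ox|Ox] := pselect (Om x).
  by rewrite step_in// mem_set.
by rewrite step_out// memNset.
Qed.

Lemma integral_cells (g : T -> R) (rep : J -> T) (eta : R) :
  measurable_fun setT g -> (forall x, 0 <= g x) -> (forall x, ~ Om x -> g x = 0) ->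
  0 <= eta -> (forall x, Om x -> `|g x - g (rep (c x))| <= eta) ->
  `|\sum_j cell_mass j * g (rep j) - fine (\int[mu]_x (g x)%:E)%E| <= eta.
Proof.
move=> mg g0 gout eta0 gapp.
have mgE : measurable_fun setT (fun x => (g x)%:E) by apply/measurable_EFinP.
have I0 : (0 <= \int[mu]_x (g x)%:E)%E by apply: integral_ge0 => x _; rewrite lee_fin.
pose S := \sum_j g (rep j) * cell_mass j.
have -> : \sum_j cell_mass j * g (rep j) = S.
  by apply: eq_bigr => j _; rewrite mulrC.
have up : (\int[mu]_x (g x)%:E <= (S + eta)%:E)%E.
  have -> : S + eta = \sum_j (g (rep j) + eta) * cell_mass j.
    under [RHS]eq_bigr do rewrite mulrDl.
    by rewrite big_split /= -mulr_sumr sum_cell_mass mulr1.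
  rewrite -integral_step => [|j]; last by rewrite addr_ge0.
  apply: ge0_le_integral => //; [by move=> x _; rewrite lee_fin|exact: measurable_step|].
  move=> x _; rewrite lee_fin; have [Ox|Ox] := pselect (Om x); last first.
    by rewrite gout// step_out.
  rewrite step_in//; have := gapp x Ox; rewrite ler_norml => /andP[_].
  by rewrite lerBlDl.
have low : (S%:E <= \int[mu]_x (g x)%:E + eta%:E)%E.
  have -> : eta%:E = (\int[mu]_x (step (fun=> eta) x)%:E)%E.
    by rewrite integral_step// -mulr_sumr sum_cell_mass mulr1.
  rewrite -ge0_integralD//; last 3 first.
  - by move=> x _; rewrite lee_fin.
  - by move=> x _; rewrite lee_fin sumr_ge0// => j _; rewrite mulr_ge0.
  - exact: measurable_step.
  rewrite -integral_step//; apply: ge0_le_integral => //.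
  - by move=> x _; rewrite lee_fin sumr_ge0// => j _; rewrite mulr_ge0.
  - exact: measurable_step.
  - by apply: emeasurable_funD => //; exact: measurable_step.
  move=> x _; rewrite -EFinD lee_fin; have [Ox|Ox] := pselect (Om x); last first.
    by rewrite gout// !step_out// addr0.
  rewrite !step_in//; have := gapp x Ox; rewrite ler_norml => /andP[+ _].
  by rewrite lerBrDl addrC -lerBlDl; lra.
have Ifin : (\int[mu]_x (g x)%:E)%E \is a fin_num.
  by rewrite ge0_fin_numE// (le_lt_trans up)// ltry.
move: up low; rewrite -(fineK Ifin) -EFinD !lee_fin ler_norml => ? ?.
by apply/andP; split; lra.
Qed.

End step_integral.

Section initial_discretization.
Variables (R : realType) (d : nat) (Om : set 'rV[R]_d).
Variables (mu : probability (borel_rV R d) R) (N : nat).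

Lemma Lq_norm_powR (q : R) (f : 'rV[R]_d -> R) : q != 0 ->
  Lq_norm mu q f `^ q = fine (\int[mu]_x (`|f x| `^ q)%:E)%E.
Proof.
by move=> q0; rewrite /Lq_norm -fine_poweR powR_Lnorm//.
Qed.

Lemma Lq_norm_ge0 (q : R) (f : 'rV[R]_d -> R) : 0 <= Lq_norm mu q f.
Proof. by rewrite fine_ge0// Lnorm_ge0. Qed.

(** Every [f] in the span has the same small relative oscillation on the cells
   of one finite partition, because its coefficients are controlled by its
   norm; the masses of the cells are then rounded to multiples of the inverse of
   a large number of points. *)
Lemma initial_discretization (u : 'I_N -> 'rV[R]_d -> R^o) (q M e : R) (m : nat) :
  compact Om -> mu Om = 1%E -> (forall i, Ccont Om (u i)) ->
  (forall c : 'I_N -> R, (forall x, \sum_i c i * u i x = 0) -> forall i, c i = 0) ->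
  2 <= q -> 0 <= M -> 0 < e -> (0 < m)%N ->
  (forall (c : 'I_N -> R) x, `|\sum_i c i * u i x| <=
     M * Lq_norm mu q (fun x => \sum_i c i * u i x)) ->
  exists s (y : nat -> 'rV[R]_d), (forall j, Om (y j)) /\
    forall (c : 'I_N -> R) f, f = (fun x => \sum_i c i * u i x) ->
    `|emp_mean q (2 ^ s * m) y f - Lq_norm mu q f `^ q| <= e * Lq_norm mu q f `^ q.
Proof.
move=> Omc muOm uC ufree q2 M0 e0 m0 fsup.
have q0 : 0 < q by lra.
have q1 : 1 < q by lra.
have mOm := compact_measurable_rV Omc.
have [K K0 coef] := coefficients_le_sup ufree.
have mu_u i : measurable_fun [set: borel_rV R d] (u i : borel_rV R d -> R).
  exact: Ccont_measurable (uC i).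
pose Kb := \sum_i unif_norm Om (u i).
have [x0 Ox0] : exists x, Om x.
  apply: contrapT => h; move: muOm; rewrite (_ : Om = set0) ?measure0.
    by move=> [] /esym /eqP; rewrite oner_eq0.
  by apply/seteqP; split => // x Ox; apply: h; exists x.
have un0 i : 0 <= unif_norm Om (u i).
  by apply: le_trans (Ccont_le_unif_norm Omc (uC i) Ox0).
have uK i x : `|u i x| <= Kb.
  apply: (@le_trans _ _ (unif_norm Om (u i))); last first.
    by rewrite /Kb (bigD1 i)//= lerDl sumr_ge0.
  have [Ox|Ox] := pselect (Om x); first exact: Ccont_le_unif_norm.
  by have [_ ->] := uC i; rewrite ?normr0.
pose D := q * M `^ (q - 1) * (K * M).
have D0 : 0 <= D by rewrite !mulr_ge0 ?powR_ge0// ltW.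
pose dl := e / 2 / (D + 1).
have dl0 : 0 < dl by rewrite !divr_gt0//; lra.
have Ddl : D * dl <= e / 2.
  rewrite /dl mulrA ler_pdivrMr; last lra.
  by rewrite mulrC ler_wpM2l ?lerDl// divr_ge0 ?(ltW e0).
have [J [c [mc cP]]] := @finite_measurable_partition _ (borel_rV R d) R N u Kb dl dl0 mu_u uK.
have /choice [rep repP] : forall j : J, exists x, Om x /\
    forall z, Om z -> c z = j -> c x = j.
  move=> j; have [[x [Ox cx]]|h] := pselect (exists x, Om x /\ c x = j).
    by exists x.
  by exists x0; split => // z Oz cz; case: h; exists z.
pose E := 4 * #|J|%:R * M `^ q / e.
pose s := Num.truncn E.
have sE : E <= (2 ^ s * m)%:R.
  apply: (@le_trans _ _ s.+1%:R); first by apply/ltW/truncnS_gt.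
  rewrite ler_nat; apply: (@leq_trans (2 ^ s)); first exact: ltn_expl.
  by rewrite leq_pmulr.
set n := (2 ^ s * m)%N in sE.
have n0 : 0 < n%:R :> R by rewrite ltr0n /n muln_gt0 expn_gt0.
have [pts ptsP] := rational_weights (c x0) n
  (cell_mass_ge0 mu Om c) (sum_cell_mass mOm muOm mc).
exists s, (fun j => rep (pts j)); split; first by move=> j; have [] := repP (pts j).
move=> a f fE; set L := Lq_norm mu q f.
have L0 : 0 <= L by apply: Lq_norm_ge0.
have fL x : `|f x| <= M * L by rewrite /L fE; apply: fsup.
have osc x : Om x -> `| `|f x| `^ q - `|f (rep (c x))| `^ q| <= D * dl * L `^ q.
  move=> Ox; have cx : c x = c (rep (c x)).
    by have [_ /(_ x Ox erefl)] := repP (c x).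
  apply: le_trans (@powR_lipschitz R q (M * L) _ _ q1 _ _) _; rewrite ?normr_ge0 ?fL//.
  have df : `|f x - f (rep (c x))| <= K * (M * L) * dl.
    have coefL : \sum_i `|a i| <= K * (M * L).
      by apply: coef => z; rewrite -[X in `|X|](congr1 (@^~ z) fE).
    rewrite fE -sumrB; apply: le_trans (ler_norm_sum _ _ _) _.
    apply: (@le_trans _ _ ((\sum_i `|a i|) * dl)).
      rewrite mulr_suml; apply: ler_sum => i _.
      by rewrite -mulrBr normrM ler_wpM2l// cP.
    by rewrite ler_wpM2r ?(ltW dl0).
  apply: (@le_trans _ _ (q * (M * L) `^ (q - 1) * (K * (M * L) * dl))).
    rewrite ler_wpM2l ?mulr_ge0 ?powR_ge0 ?(ltW q0)//.
    by apply: le_trans df; apply: ler_dist_dist.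
  rewrite powRM// -[L `^ q]mulr_powRB1// le_eqVlt; apply/orP; left; apply/eqP.
  by rewrite /D; ring.
have mf : measurable_fun [set: borel_rV R d] (f : borel_rV R d -> R).
  by rewrite fE; apply: measurable_sum => i; apply: measurable_funM.
have mfq : measurable_fun [set: borel_rV R d] ((fun x => `|f x| `^ q) : borel_rV R d -> R).
  apply: (@measurableT_comp _ _ _ _ _ _ (@powR R ^~ q)) => //.
  exact: measurableT_comp.
have fout x : ~ Om x -> `|f x| `^ q = 0.
  move=> Ox; rewrite fE big1 ?normr0 ?powR0 ?gt_eqF// => i _.
  by have [_ ->] := uC i; rewrite ?mulr0.
have Lq0 : 0 <= L `^ q by apply: powR_ge0.
have := @integral_cells _ (borel_rV R d) R mu Om J c mOm muOm mc _ rep (D * dl * L `^ q) mfq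
  (fun x => powR_ge0 _ _) fout _ osc.
rewrite -Lq_norm_powR ?gt_eqF// -/L => /(_ _)/wrap[].
  by rewrite mulr_ge0 ?powR_ge0// mulr_ge0 ?(ltW dl0).
have := ptsP (fun j => `|f (rep j)| `^ q) ((M * L) `^ q) _ => /(_ _)/wrap[].
  by move=> j; rewrite powR_ge0 ler_powR_base ?fL// ltW.
set S := \sum_(k < n) _; set I := \sum_j _ => h1 h2.
have -> : emp_mean q n (fun j => rep (pts j)) f = n%:R^-1 * S by [].
have h3 : `|n%:R^-1 * S - I| <= e / 2 * L `^ q.
  have -> : n%:R^-1 * S - I = n%:R^-1 * (S - n%:R * I) by field; rewrite gt_eqF.
  rewrite normrM gtr0_norm ?invr_gt0// mulrC ler_pdivrMr//.
  apply: le_trans h1 _; rewrite powRM// mulrA [leRHS]mulrAC ler_wpM2r//.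
  move: sE; rewrite /E ler_pdivrMr// natrM; lra.
have -> : n%:R^-1 * S - L `^ q = (n%:R^-1 * S - I) + (I - L `^ q) by ring.
apply: le_trans (ler_normD _ _) _.
have : D * dl * L `^ q <= e / 2 * L `^ q by rewrite ler_wpM2r.
lra.
Qed.

End initial_discretization.

(** * The sampling theorem *)

(** The last condition bounds [m] from below in terms of [m] itself; it can be met
   because enlarging [C] enlarges [m] faster than the power of its logarithm. *)
Lemma sample_size (R : realType) (q C1 : R) : 2 <= q -> 0 < C1 ->
  exists2 C : R, 0 < C & forall (N : nat) (B : R), (0 < N)%N -> 1 <= B ->
  exists m : nat, [/\ (0 < m)%N,
    m%:R <= C * B `^ q * N%:R * log2 (2 * B * N%:R) ^+ 3 &
    C1 * (B `^ q * N%:R) * ln (4 * m%:R + 1) ^+ 3 <= m%:R].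
Proof.
move=> q2 C10; pose z := 2 + 10 * C1 * (q + 9) ^+ 3.
have q9 : 0 < (q + 9) ^+ 3 by rewrite exprn_gt0//; lra.
have z2 : 2 <= z.
  by rewrite lerDl mulr_ge0 ?(ltW q9)// mulr_ge0// ltW.
have zC1 : 10 * C1 * (q + 9) ^+ 3 <= z ^+ 3.
  apply: (@le_trans _ _ z); first by rewrite lerDr.
  by rewrite -[leLHS]expr1 ler_eXn2l//; lra.
have z8 : 8 <= z ^+ 3.
  by apply: (@le_trans _ _ (2 ^+ 3)); [rewrite !exprS expr0; lra|rewrite lerXn2r ?nnegrE//; lra].
pose C := z ^+ 6 / 5.
have z6 : z ^+ 6 = z ^+ 3 * z ^+ 3 by rewrite -exprD.
have C2 : 2 <= C by rewrite /C z6 ler_pdivlMr//; nra.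
exists C; first lra.
move=> N B N0 B1; set Y := B `^ q * N%:R; set l := log2 _.
have n1 : 1 <= N%:R :> R by rewrite ler1n.
have Bq1 : 1 <= B `^ q by apply: powR_ge1; lra.
have Y1 : 1 <= Y by rewrite /Y; nra.
have BN : 1 <= B * N%:R by nra.
have l20 : 0 < ln 2 :> R by rewrite ln_gt0//; lra.
have l21 : ln 2 <= 1 :> R by have := @le_ln1Dx R 1; rewrite (_ : 1 + 1 = 2) //; apply; lra.
have lE : ln (2 * B * N%:R) = l * ln 2 by rewrite /l /log2 mulfVK// gt_eqF.
have l1 : 1 <= l.
  by rewrite /l /log2 ler_pdivlMr// mul1r ler_ln ?posrE//; nra.
have lnY : ln Y <= q * l.
  have h1 : ln (2 * B * N%:R) <= l by rewrite lE; nra.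
  have lnB0 : 0 <= ln B by apply: ln_ge0.
  have lnN0 : 0 <= ln N%:R :> R by apply: ln_ge0.
  have h2 : ln B + ln N%:R <= ln (2 * B * N%:R).
    rewrite -mulrA !lnM ?posrE//; [lra|lra|lra|].
    by rewrite mulr_gt0//; lra.
  rewrite /Y lnM ?posrE ?powR_gt0//; [|lra..].
  rewrite ln_powR; nra.
pose v := C * Y * l ^+ 3.
have l3 : 1 <= l ^+ 3 by rewrite exprn_ege1.
have CY2 : 2 <= C * Y by nra.
have v2 : 2 <= v by rewrite /v; nra.
pose m := Num.truncn v.
have v0 : 0 <= v by lra.
have /andP[mv vm] := truncn_itv v0.
rewrite -/m -natr1 in mv vm.
exists m; split.
- by rewrite -(ltr_nat R); lra.
- by apply: le_trans mv _; rewrite /v /Y !mulrA.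
have z0 : 0 < z by lra.
have lnm : ln (4 * m%:R + 1) <= (q + 9) * z * l.
  apply: (@le_trans _ _ (ln (5 * v))).
    by rewrite ler_ln ?posrE//; have : (0 : R) <= m%:R by []; lra.
  have -> : 5 * v = z ^+ 6 * Y * l ^+ 3 by rewrite /v /C; field.
  have l0 : 0 < l by lra.
  have Y0 : 0 < Y by lra.
  have zY : 0 < z ^+ 6 * Y by apply: mulr_gt0; rewrite ?exprn_gt0.
  have zp : 0 < z ^+ 6 by apply: exprn_gt0.
  have lp : 0 < l ^+ 3 by apply: exprn_gt0.
  rewrite (lnM zY lp) (lnM zp Y0) !lnXn//.
  rewrite -[ln z *+ _]mulr_natl -[ln l *+ _]mulr_natl.
  have := ln_sublinear z0; have := ln_sublinear l0.
  have : 1 * 1 <= z * l by apply: ler_pM; lra.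
  have : l <= z * l by rewrite ler_peMl//; lra.
  have : z <= z * l by rewrite ler_peMr//; lra.
  have : q * l <= q * (z * l) by rewrite ler_wpM2l//; nra.
  rewrite -mulrA mulrDl; move: lnY.
  by move: (z * l) (ln z) (ln l) (ln Y) => *; lra.
have lnm0 : 0 <= ln (4 * m%:R + 1) :> R.
  by apply: ln_ge0; have : (0 : R) <= m%:R by []; lra.
apply: (@le_trans _ _ (C1 * Y * ((q + 9) * z * l) ^+ 3)).
  rewrite ler_wpM2l ?mulr_ge0 ?(ltW C10)//; first lra.
  by rewrite lerXn2r ?nnegrE// (le_trans lnm0).
apply: (@le_trans _ _ (v / 2)); last lra.
have -> : v / 2 = z ^+ 3 * (Y * l ^+ 3 * z ^+ 3) / 10 by rewrite /v /C z6; field.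
have -> : C1 * Y * ((q + 9) * z * l) ^+ 3 =
  (10 * C1 * (q + 9) ^+ 3) * (Y * l ^+ 3 * z ^+ 3) / 10 by field.
have T0 : 0 <= Y * l ^+ 3 * z ^+ 3.
  have z30 : 0 <= z ^+ 3 by lra.
  by apply: mulr_ge0 => //; apply: mulr_ge0; lra.
by rewrite ler_wpM2r// ler_wpM2r.
Qed.

Theorem theorem2p2 (R : realType) (q epsilon : R) (hq : 2 <= q)
    (heps0 : 0 < epsilon) (heps1 : epsilon < 1) :
  exists C : R, 0 < C /\
    forall (d : nat) (Omega : set 'rV[R]_d) (mu : probability (borel_rV R d) R)
           (N : nat) (X : set ('rV[R]_d -> R^o)) (B : R),
      compact Omega ->
      mu Omega = 1%E ->
      (0 < N)%N ->
      X `<=` Ccont Omega ->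
      is_subspace_of_dim X N ->
      1 <= B ->
      (forall f, X f ->
        unif_norm Omega f <= B * N%:R `^ q^-1 * Lq_norm mu q f) ->
      exists (m : nat) (xi : 'I_m -> 'rV[R]_d),
        (0 < m)%N /\
        m%:R <= C * B `^ q * N%:R * log2 (2 * B * N%:R) ^+ 3 /\
        (forall j, Omega (xi j)) /\
        forall f, X f ->
          (1 - epsilon) * Lq_norm mu q f `^ q
            <= m%:R^-1 * \sum_(j < m) `|f (xi j)| `^ q
            <= (1 + epsilon) * Lq_norm mu q f `^ q.
Proof.
have q0 : 0 < q by lra.
have e2 : 0 < epsilon / 2 <= 2^-1 by apply/andP; split; lra.
have [C1 C10 thin] := thinning hq e2.
have [C C0 size] := sample_size hq C10.
exists C; split => // d Om mu N X B Omc muOm N0 XC Xdim B1 nik.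
have [m [m0 mC mln]] := size N B N0 B1.
have n1 : 1 <= N%:R :> R by rewrite ler1n.
have Bq1 : 1 <= B `^ q by apply: powR_ge1; lra.
have P1 : 1 <= B `^ q * N%:R by nra.
have [u [ufree XE]] := Xdim.
have combE (c : 'I_N -> R) : \sum_i c i *: u i = (fun x => \sum_i c i * u i x) :> ('rV[R]_d -> R^o).
  by apply/funext => x; rewrite fct_sumE.
have Xc (c : 'I_N -> R) : X (fun x => \sum_i c i * u i x).
  by rewrite XE; exists c; rewrite combE.
have Xu i : X (u i).
  rewrite XE; exists (fun j => (j == i)%:R); rewrite (bigD1 i)//= eqxx scale1r.
  by rewrite big1 ?addr0// => j /negbTE ->; rewrite scale0r.
have free (c : 'I_N -> R) : (forall x, \sum_i c i * u i x = 0) -> forall i, c i = 0.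
  by move=> h; apply: ufree; rewrite combE; apply/funext => x; rewrite h.
pose M := B * N%:R `^ q^-1.
have M0 : 0 <= M by rewrite mulr_ge0 ?powR_ge0//; lra.
have Xsup f x : X f -> `|f x| <= M * Lq_norm mu q f.
  move=> Xf; have [Ox|Ox] := pselect (Om x).
    by apply: le_trans (nik f Xf); apply: Ccont_le_unif_norm => //; apply: XC.
  by have [_ /(_ x Ox) ->] := XC _ Xf; rewrite normr0 mulr_ge0 ?Lq_norm_ge0.
have e4 : 0 < epsilon / 2 / 2 by lra.
have [s [y [yOm yP]]] := initial_discretization Omc muOm (fun i => XC _ (Xu i)) free hq M0
  e4 m0 (fun c x => Xsup _ x (Xc c)).
have Xlin : lin_closed (X : set ('rV[R]_d -> R)).
  move=> a b f g; rewrite XE => -[c ->] [c' ->]; exists (fun i => a * c i + b * c' i).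
  rewrite !combE; apply/funext => x; rewrite !mulr_sumr -big_split /=.
  by apply: eq_bigr => i _; ring.
have [||y' y'Om y'P] := thin _ (X : set ('rV[R]_d -> R)) (fun f => Lq_norm mu q f `^ q) Om
  (B `^ q * N%:R) m s y Xlin m0 P1 (fun f _ => powR_ge0 _ _) _ mln yOm.
- move=> f x Xf _; have -> : B `^ q * N%:R = M `^ q.
    by rewrite powRM ?powR_ge0//; [rewrite -powRrM mulVf ?gt_eqF// powRr1|lra].
  by rewrite -powRM ?Lq_norm_ge0// ler_powR_base ?(ltW q0)// Xsup.
- move=> f; rewrite XE => -[c ->]; apply: (yP c); exact: combE.
exists m, (fun j => y' j); split => //; split => //; split => // f Xf.
have := y'P f Xf; rewrite /emp_mean ler_norml.
have := powR_ge0 (Lq_norm mu q f) q.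
set L := Lq_norm mu q f `^ q => L0 /andP[h1 h2].
have eL : 0 <= epsilon * L by rewrite mulr_ge0// ltW.
by apply/andP; split; lra.
Qed.
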